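(* Let $\mathbf{q}=(q_1,q,q_2)$ be an affine triple of nonzero complex numbers. Then, up to interchanging $q_1$ and $q_2$, $\mathbf{q}$ is one of the triples in the following list (in rows listing several triples, $\mathbf{q}$ is one of them), and its characteristic sequence is periodic with the repeating block given after the arrow: 1. $(\zeta,\zeta,\zeta)$, $\zeta\in\mu_3$; $\to(2)$. 2. $(\zeta^2,\zeta^5,\zeta^2)$, $\zeta\in\mu_6$; $\to(2)$. 3. $(\zeta,\zeta^4,\zeta^4)$, $\zeta\in\mu_6$; $\to(2)$. 4. $(\zeta^4,\zeta,\zeta^2)$, $(\zeta^2,\zeta^3,\zeta^2)$, $(\zeta^2,\zeta,\zeta^4)$, $\zeta\in\mu_6$; $\to(2)$. 5. $(\zeta,\zeta^{10},\zeta^4)$, $\zeta\in\mu_{12}$; $\to(2)$. 6. $(\zeta,\zeta^4,\zeta^4)$, $\zeta\in\mu_5$; $\to(1,4)$. 7. $(\zeta^4,\zeta^4,\zeta)$, $\zeta\in\mu_8$; $\to(1,4)$. 8. $(\zeta,\zeta^9,\zeta^4)$, $\zeta\in\mu_{10}$; $\to(1,4)$. 9. $(\zeta,\zeta^{10},\zeta^9)$, $(\zeta^9,\zeta^8,\zeta^4)$, $\zeta\in\mu_{12}$; $\to(2,3,1,3)$. 10. $(\zeta,\zeta^8,\zeta^6)$, $(\zeta^6,\zeta^4,\zeta^3)$, $(\zeta^3,\zeta^2,\zeta^9)$, $(\zeta^9,\zeta^4,\zeta^6)$, $(\zeta^6,\zeta^8,\zeta^7)$, $\zeta\in\mu_{12}$;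 $\to(4,1,3,3,1)$. 11. $(\zeta,\zeta^{12},\zeta^9)$, $(\zeta^9,\zeta^6,\zeta^4)$, $\zeta\in\mu_{18}$; $\to(6,1,3,1)$. 12. $(p,p^{-2},p)$, $p\in\mathbb{C}^\times\setminus\{\pm1\}$; $\to(2)$. 13. $(p,p^{-2},-p)$, $p\in\mathbb{C}^\times\setminus\{\pm1\}$; $\to(2)$. 14. $(p,p^{-4},p^4)$, $p\in\mathbb{C}^\times\setminus\{\pm1\}$, $p\notin\mu_3$, $p\notin\mu_4$; $\to(1,4)$.
   Context: $\mu_n$ denotes the set of primitive $n$-th roots of unity in $\mathbb{C}$. For a triple $(q_1,q,q_2)$ of nonzero complex numbers and $i=1,2$ let $m_i:=\min\{m\in\mathbb{N}_0 \mid 1+q_i+\dots+q_i^m=0 \text{ or } q_i^mq=1\}$ when this set is nonempty. Define $\sigma_1(q_1,q,q_2)=(q_1,\,q_1^{-2m_1}q^{-1},\,q_1^{m_1^2}q^{m_1}q_2)$ and $\sigma_2(q_1,q,q_2)=(q_1q^{m_2}q_2^{m_2^2},\,q_2^{-2m_2}q^{-1},\,q_2)$. Starting from $\mathbf{q}_0=\mathbf{q}$ define $\mathbf{q}_{j+1}=\sigma_1(\mathbf{q}_j)$ for even $j$, $\mathbf{q}_{j+1}=\sigma_2(\mathbf{q}_j)$ for odd $j$ (and backwards $\mathbf{q}_{-1}=\sigma_2(\mathbf{q}_0)$, $\mathbf{q}_{-2}=\sigma_1(\mathbf{q}_{-1})$, etc.), assuming all the required $m_i$ are defined at every step. The characteristic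 sequence $(c_j)_{j\in\mathbb{Z}}$ records the integer $m_i$ used in the step between $\mathbf{q}_j$ and $\mathbf{q}_{j+1}$ (so $c_0=m_1(\mathbf{q}_0)$, $c_{-1}=m_2(\mathbf{q}_0)$). Quiddity cycles: classes $(\!(c_1,\dots,c_n)\!)$ of sequences in $\mathbb{N}_0^n$ up to dihedral action on positions, forming the smallest set containing $(\!(0,0)\!)$ and closed under $(\!(c_1,\dots,c_n)\!)\mapsto(\!(c_1+1,1,c_2+1,c_3,\dots,c_n)\!)$. A bi-infinite sequence is affine if there exist representatives $\mathbf{c}'_k=(c'_{k,1},\dots,c'_{k,r_k})$, $r_k\ge2$, $k\in\mathbb{Z}$, of quiddity cycles such that it equals $(\dots,c'_{k-1,r_{k-1}}+2+c'_{k,1},c'_{k,2},\dots,c'_{k,r_k-1},c'_{k,r_k}+2+c'_{k+1,1},c'_{k+1,2},\dots)$ (consecutive blocks concatenated, merging the last entry of each block with the first entry of the next by adding them plus $2$). A triple is affine if its characteristic sequence is defined and affine. *)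

(* Defs.v *)
From mathcomp Require Export all_boot all_order all_algebra.
From mathcomp Require Export reals.
From mathcomp Require Export complex.

Set Implicit Arguments.
Unset Strict Implicit.
Unset Printing Implicit Defensive.

Import Order.TTheory GRing.Theory Num.Theory.
Local Open Scope ring_scope.
Local Open Scope complex_scope.

(* (q1, q, q2) is encoded as ((q1, q), q2); the complex numbers are [R[i]]
   for [R : realType]. *)
Definition triple (R : realType) : Type := (R[i] * R[i] * R[i])%type.

Definition swap (R : realType) (t : triple R) : triple R :=
  let: (x, y, z) := t in (z, y, x).

Definition m_cond (R : realType) (x y : R[i]) (m : nat) : Prop :=
  \sum_(k < m.+1) x ^+ k = 0 \/ x ^+ m * y = 1.

(* The minimum is a relation, since it is only defined when the set of
   admissible values is nonempty. *)
Definition is_m (R : realType) (x y : R[i]) (m : nat) : Prop :=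
  m_cond x y m /\ (forall k : nat, m_cond x y k -> (m <= k)%N).

Definition is_m1 (R : realType) (t : triple R) (m : nat) : Prop :=
  let: (x, y, z) := t in is_m x y m.

Definition is_m2 (R : realType) (t : triple R) (m : nat) : Prop :=
  let: (x, y, z) := t in is_m z y m.

(* [sigma1 m] and [sigma2 m] are the reflections for given values m of m_1
   and m_2. *)
Definition sigma1 (R : realType) (m : nat) (t : triple R) : triple R :=
  let: (x, y, z) := t in
  (x, x ^- (2 * m)%N * y^-1, x ^+ (m ^ 2)%N * y ^+ m * z).

Definition sigma2 (R : realType) (m : nat) (t : triple R) : triple R :=
  let: (x, y, z) := t in
  (x * y ^+ m * z ^+ (m ^ 2)%N, z ^- (2 * m)%N * y^-1, z).

(* The step between q_j and q_{j+1}: sigma_1 for even j, sigma_2 for odd j,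
   whichever of the two triples is the source. *)
Definition step (R : realType) (j : int) (m : nat) (s t : triple R) : Prop :=
  if odd `|j|%N then is_m2 s m /\ t = sigma2 m s
  else is_m1 s m /\ t = sigma1 m s.

(* Both directions are computed starting from q_0, so that c_{-1} = m_2(q_0). *)
Definition characteristic_sequence (R : realType) (t : triple R)
    (c : int -> nat) : Prop :=
  exists Q : int -> triple R,
    [/\ Q 0 = t,
        forall j : int, 0 <= j -> step j (c j) (Q j) (Q (j + 1))
      & forall j : int, j < 0 -> step j (c j) (Q (j + 1)) (Q j)].

(* [quiddity s] says that s is a representative of a quiddity cycle; rotations
   and reversal generate the dihedral action. *)
Inductive quiddity : seq nat -> Prop :=
| quiddity00 : quiddity [:: 0; 0]%N
| quiddity_insert (a b : nat) (s : seq nat) :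
    quiddity [:: a, b & s] -> quiddity [:: a.+1, 1%N, b.+1 & s]
| quiddity_rot (n : nat) (s : seq nat) : quiddity s -> quiddity (rot n s)
| quiddity_rev (s : seq nat) : quiddity s -> quiddity (rev s).

(* [p k] is the position at which the last entry of block k - 1 and the first
   entry of block k are merged. *)
Definition affine_sequence (c : int -> nat) : Prop :=
  exists (B : int -> seq nat) (p : int -> int),
    [/\ forall k : int, quiddity (B k) /\ (2 <= size (B k))%N,
        forall k : int, p (k + 1) = p k + (size (B k)).-1%:Z,
        forall k : int,
          c (p k) = (last 0%N (B (k - 1)%R) + 2 + head 0%N (B k))%N
      & forall (k : int) (i : nat), (0 < i)%N -> (i < (size (B k)).-1)%N ->
          c (p k + i%:Z) = nth 0%N (B k) i].

Definition affine_triple (R : realType) (t : triple R) : Prop :=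
  exists c : int -> nat, characteristic_sequence t c /\ affine_sequence c.

(* The period may start at any index. *)
Definition periodic_with_block (c : int -> nat) (b : seq nat) : Prop :=
  exists s : int, forall j : int,
    c (s + j) = nth 0%N b `|(j %% (size b)%:Z)%Z|%N.

Variant listed (R : realType) : triple R -> seq nat -> Prop :=
| Row1 (z : R[i]) :
    3.-primitive_root z -> listed (z, z, z) [:: 2]%N
| Row2 (z : R[i]) :
    6.-primitive_root z -> listed (z ^+ 2, z ^+ 5, z ^+ 2) [:: 2]%N
| Row3 (z : R[i]) :
    6.-primitive_root z -> listed (z, z ^+ 4, z ^+ 4) [:: 2]%N
| Row4 (z : R[i]) (t : triple R) :
    6.-primitive_root z ->
    t \in [:: (z ^+ 4, z, z ^+ 2); (z ^+ 2, z ^+ 3, z ^+ 2);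
              (z ^+ 2, z, z ^+ 4)] ->
    listed t [:: 2]%N
| Row5 (z : R[i]) :
    12.-primitive_root z -> listed (z, z ^+ 10, z ^+ 4) [:: 2]%N
| Row6 (z : R[i]) :
    5.-primitive_root z -> listed (z, z ^+ 4, z ^+ 4) [:: 1; 4]%N
| Row7 (z : R[i]) :
    8.-primitive_root z -> listed (z ^+ 4, z ^+ 4, z) [:: 1; 4]%N
| Row8 (z : R[i]) :
    10.-primitive_root z -> listed (z, z ^+ 9, z ^+ 4) [:: 1; 4]%N
| Row9 (z : R[i]) (t : triple R) :
    12.-primitive_root z ->
    t \in [:: (z, z ^+ 10, z ^+ 9); (z ^+ 9, z ^+ 8, z ^+ 4)] ->
    listed t [:: 2; 3; 1; 3]%N
| Row10 (z : R[i]) (t : triple R) :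
    12.-primitive_root z ->
    t \in [:: (z, z ^+ 8, z ^+ 6); (z ^+ 6, z ^+ 4, z ^+ 3);
              (z ^+ 3, z ^+ 2, z ^+ 9); (z ^+ 9, z ^+ 4, z ^+ 6);
              (z ^+ 6, z ^+ 8, z ^+ 7)] ->
    listed t [:: 4; 1; 3; 3; 1]%N
| Row11 (z : R[i]) (t : triple R) :
    18.-primitive_root z ->
    t \in [:: (z, z ^+ 12, z ^+ 9); (z ^+ 9, z ^+ 6, z ^+ 4)] ->
    listed t [:: 6; 1; 3; 1]%N
| Row12 (p : R[i]) :
    p != 0 -> p != 1 -> p != -1 -> listed (p, p ^- 2, p) [:: 2]%N
| Row13 (p : R[i]) :
    p != 0 -> p != 1 -> p != -1 -> listed (p, p ^- 2, - p) [:: 2]%N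
| Row14 (p : R[i]) :
    p != 0 -> p != 1 -> p != -1 ->
    ~~ 3.-primitive_root p -> ~~ 4.-primitive_root p ->
    listed (p, p ^- 4, p ^+ 4) [:: 1; 4]%N.

(* Main.v *)
Require Import Defs.
From mathcomp Require Import boolp zify ring cyclic separable cyclotomic.

(* Quiddity cycles are the vertex degrees of triangulated polygons, so an affine
   sequence is obtained by gluing triangulated polygons along a line. Conway-Coxeter
   labels give a positive solution [y] of [c_j y_j = y_(j-1) + y_(j+1)], hence every
   continuant of a window of [c] is positive; and looking at triangles of maximal
   depth shows that [c] is constant 2, or alternates 1 and 4, or contains, up to
   reversal, one of a few short words.

   Every value [c_j = m] is a monomial equation [q_i^(m+1) = 1] or [q_i^m q = 1].
   Each of the short words forces all entries of some triple to be roots of unity of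
   an explicit order [N], which leaves finitely many triples of exponents mod [N].
   For each of them the characteristic sequence is computed: it is undefined, or it
   has a nonpositive continuant, or it has a value above a known bound, or the triple
   is listed. The two remaining sequences also allow the one-parameter families. *)

(** Being affine concerns the whole sequence, while a computation sees a finite window. Positivity
    of continuants is a consequence that a window can refute, so it stands in for affineness once a
    word has been found.

    The words are chosen long enough to be overdetermined. Up to monomials, the equations of a word
    leave a root of unity of order dividing some d <= 5 and one unknown y; one more equation, raised
    to a power that removes the other factors, gives y^N = 1. Every modulus N below arises in this
    way, and each equation has two alternatives, hence the lists of moduli. Along the constant 2 and
    along 1, 4 one choice of alternatives stays consistent forever, and its solutions are the
    one-parameter families.

    Recognising a single triple is enough: the triples of a listed row recur with a common period,
    so the initial triple lies in the same row. *)

Set Implicit Arguments.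
Unset Strict Implicit.
Unset Printing Implicit Defensive.
Import Order.TTheory GRing.Theory Num.Theory.

(** * Affine sequences *)

(* A triangulated polygon with a base edge, as a binary tree: [Leaf] is the bare edge
   and [Node l r] glues [l] and [r] to the sides of the triangle on the base. [lft],
   [inn] and [rgt] are the numbers of triangles at the left end of the base, at the
   other vertices from left to right, and at its right end. *)
Inductive tree := Leaf | Node of tree & tree.

Fixpoint lft t := if t is Node l _ then (lft l).+1 else 0.
Fixpoint rgt t := if t is Node _ r then (rgt r).+1 else 0.
Fixpoint inn t :=
  if t is Node l r then inn l ++ (rgt l + lft r).+1 :: inn r else [::].

Definition code t := lft t :: rcons (inn t) (rgt t).

(** Glues a triangle to the side next to the left end of the base; on [code] this is the insertion
    of [quiddity_insert]. *)
Fixpoint add_ear t := if t is Node l r then Node (add_ear l) r else Node Leaf Leaf.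

Definition incr_head s := if s is a :: s' then a.+1 :: s' else [::].

Lemma lft_add_ear t : lft (add_ear t) = (lft t).+1.
Proof. by elim: t => //= l -> r. Qed.

(** A bare edge is left out because there the neighbour of the left end is the other end of the
    base, which [rgt] counts. *)
Lemma add_ear_Node l r :
  rgt (add_ear (Node l r)) = rgt (Node l r) /\
  inn (add_ear (Node l r)) = 1 :: incr_head (inn (Node l r)).
Proof.
split=> //; elim: l r => [|l1 IH1 l2 _] r //=.
move: (IH1 l2) => /= ->.
case E: (inn l1 ++ _) => [|x s] //.
by move/(congr1 size): E; rewrite size_cat /= addnS.
Qed.

(* Moves the base one edge to the left end of [t], the polygon [u] being glued to the
   old base from outside. *)
Fixpoint reroot t u :=
  if t is Node l r then
    if l is Leaf then Node r u else reroot l (Node r u)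
  else Leaf.

(** With [u = Leaf] this is rotation by one place. A general [u] is needed because each recursive
    step moves the old triangle to the outside. *)
Lemma code_reroot l r u : code (reroot (Node l r) u) =
  inn (Node l r) ++ (rgt (Node l r) + lft u) :: rcons (inn u) (lft (Node l r) + rgt u).
Proof.
elim: l r u => [|l1 IH1 l2 _] r u; first by rewrite /code /= rcons_cat /= add0n add1n.
rewrite -[LHS]/(code (reroot (Node l1 l2) (Node r u))) IH1 /=.
rewrite -!catA /= rcons_cat /= !addSn !addnS -?catA /=.
by congr (_ ++ _ :: _ ++ _ :: _ ++ _ :: rcons _ _); lia.
Qed.

Fixpoint mirror t := if t is Node l r then Node (mirror r) (mirror l) else Leaf.

Lemma mirrorE t :
  [/\ lft (mirror t) = rgt t, rgt (mirror t) = lft t & inn (mirror t) = rev (inn t)].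
Proof.
elim: t => //= l [l1 l2 l3] r [r1 r2 r3]; rewrite l1 l2 l3 r1 r2 r3.
by split=> //; rewrite rev_cat rev_cons cat_rcons addnC.
Qed.

Lemma quiddity_code s : quiddity s -> exists t, s = code t.
Proof.
elim=> {s} [|a b s _ [t Et]|n s _ [t ->]|s _ [t ->]].
- by exists Leaf.
- exists (add_ear t); rewrite /code lft_add_ear.
  case: t Et => [[-> -> ->] //|l r]; case: (add_ear_Node l r) => -> ->; rewrite /code.
  case E: (inn (Node l r)) => [|x u] /=; last by case=> -> -> ->.
  by move/(congr1 size): E => /=; rewrite size_cat /= addnS.
- elim: n => [|n [u Eu]]; first by exists t; rewrite rot0.
  have [lt_n|le_n] := ltnP n (size (code t)); last by exists t; rewrite rot_oversize// leqW.
  rewrite rotS // Eu; case: (u) => [|l r]; first by exists Leaf.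
  exists (reroot (Node l r) Leaf); rewrite code_reroot /code rot1_cons !addn0 /=.
  by rewrite -!cats1 -!catA.
- exists (mirror t); have [e1 e2 e3] := mirrorE t.
  by rewrite /code e1 e2 e3 rev_cons rev_rcons.
Qed.

(* Conway-Coxeter labels of the vertices counted by [inn], when the ends of the base
   are labelled [a] and [b]. *)
Fixpoint labels t a b :=
  if t is Node l r then labels l a (a + b) ++ (a + b) :: labels r (a + b) b else [::].

Fixpoint harmonic p ys cs q :=
  match ys, cs with
  | [::], [::] => true
  | y :: ys', c :: cs' => (c * y == p + head q ys') && harmonic y ys' cs' q
  | _, _ => false
  end.

Lemma harmonic_cat p ys1 y ys2 cs1 c cs2 q :
  harmonic p ys1 cs1 y -> c * y = last p ys1 + head q ys2 ->
  harmonic y ys2 cs2 q -> harmonic p (ys1 ++ y :: ys2) (cs1 ++ c :: cs2) q.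
Proof.
move=> + Hc H2; elim: ys1 p cs1 Hc => [|y1 ys1 IH] p [|c1 cs1] //= Hc.
  by rewrite H2 Hc eqxx.
move=> /andP[/eqP -> /IH ->//]; rewrite andbT; case: (ys1) => //.
Qed.

Lemma size_harmonic p ys cs q : harmonic p ys cs q -> size ys = size cs.
Proof. by elim: ys p cs => [|y ys IH] p [|c cs] //= /andP[_ /IH ->]. Qed.

Lemma nth_harmonic p ys cs q i : harmonic p ys cs q -> i < size cs ->
  nth 0 cs i * nth 0 ys i = nth 0 (p :: ys) i + nth 0 (rcons ys q) i.+1.
Proof.
elim: ys p cs i => [|y ys IH] p [|c cs] [|i] //= /andP[/eqP Hc H] lti.
  by rewrite Hc; case: (ys).
by rewrite (IH y).
Qed.

(** The left end carries a fan of [lft t] triangles, each of which adds [a] to the label of its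
    neighbour. The default [b] is the case of the bare edge. *)
Lemma head_labels t a b : head b (labels t a b) = lft t * a + b.
Proof.
elim: t a b => //= l IHl r _ a b.
by rewrite -cat1s catA; have:= IHl a (a + b); case: (labels l _ _) => /= [|? ? ->]; lia.
Qed.

Lemma last_labels t a b : last a (labels t a b) = rgt t * b + a.
Proof. by elim: t a b => //= l _ r IHr a b; rewrite last_cat /= IHr; lia. Qed.

Lemma harmonic_labels t a b : harmonic a (labels t a b) (inn t) b.
Proof.
elim: t a b => //= l IHl r IHr a b; apply: harmonic_cat => //.
by rewrite last_labels head_labels; lia.
Qed.

Lemma labels_gt0 t a b : 0 < a -> 0 < b -> all (leq 1) (labels t a b).
Proof.
elim: t a b => //= l IHl r IHr a b a0 b0.
by rewrite all_cat /= IHl ?IHr ?addn_gt0 ?a0.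
Qed.

Lemma size_labels t a b : size (labels t a b) = size (inn t).
Proof. exact: size_harmonic (harmonic_labels t a b). Qed.

(** * Gluing triangulated polygons along a line *)

Definition blocks (c : int -> nat) (t : int -> tree) (p : int -> int) : Prop :=
  [/\ forall k : int, p (k + 1)%R = (p k + (size (inn (t k))).+1%:Z)%R,
      forall k : int, c (p k) = rgt (t (k - 1)%R) + 2 + lft (t k)
    & forall (k : int) i, i < size (inn (t k)) ->
        c (p k + i.+1%:Z)%R = nth 0 (inn (t k)) i].

Lemma affine_blocks c : affine_sequence c -> exists t p, blocks c t p.
Proof.
case=> B [p [HB Hp Hc Hi]].
have /choice[t Ht] k : exists t, B k = code t.
  by case: (HB k) => /quiddity_code.
exists t, p; split=> k.
- by rewrite Hp Ht /code /= size_rcons.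
- by rewrite Hc !Ht /code /= last_rcons.
- move=> i lti; rewrite Hi ?Ht /code /= ?size_rcons //.
  by rewrite nth_rcons lti.
Qed.

Section Blocks.
Variables (c : int -> nat) (t : int -> tree) (p : int -> int).
Hypothesis Hb : blocks c t p.

Lemma blocks_cover j : exists k, exists2 i, i <= size (inn (t k)) & j = (p k + i%:Z)%R.
Proof.
have [Hp _ _] := Hb.
pose P x := exists k, exists2 i, i <= size (inn (t k)) & x = (p k + i%:Z)%R.
have up x : P x -> P (x + 1)%R.
  case=> k [i le_i ->]; case: (ltngtP i (size (inn (t k)))) le_i => // [lti _|-> _].
    by exists k, i.+1 => //; lia.
  by exists (k + 1)%R, 0 => //; rewrite Hp; lia.
have down x : P x -> P (x - 1)%R.
  case=> k [[|i] le_i ->]; last by exists k, i; [lia | lia].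
  exists (k - 1)%R, (size (inn (t (k - 1)%R))) => //.
  by have := Hp (k - 1)%R; rewrite subrK; lia.
have P0 : P (p 0%R) by exists 0%R, 0 => //; rewrite addr0.
rewrite -[j](subrK (p 0%R)) addrC; elim/int_ind: (j - p 0%R)%R => [|n IH|n IH].
- by rewrite addr0.
- by rewrite (_ : _ + _ = p 0 + n%:Z + 1)%R; [exact: up | lia].
- by rewrite (_ : _ + _ = p 0 - n%:Z - 1)%R; [exact: down | lia].
Qed.

Lemma blocks_unique k k' i i' : i <= size (inn (t k)) -> i' <= size (inn (t k')) ->
  (p k + i%:Z)%R = (p k' + i'%:Z)%R -> k = k' /\ i = i'.
Proof.
have [Hp _ _] := Hb.
have mono a n : (p (a + 1) <= p (a + 1 + n%:Z))%R.
  elim: n => [|n IH]; first by rewrite addr0.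
  have -> : (a + 1 + n.+1%:Z = a + 1 + n%:Z + 1)%R by lia.
  by rewrite (Hp (a + 1 + n%:Z)%R); lia.
wlog lekk' : k k' i i' / (k <= k')%R => [H|] lei lei' E.
  by case: (leP k k') => [|/ltW] /H{}H; [|case: (H i' i)]; rewrite ?E//; exact: H.
case: (ltgtP k k') lekk' => // [ltkk' _|Ek _]; last by move: E; rewrite Ek; split=> //; lia.
have := mono k `|(k' - k - 1)%R|; rewrite (_ : (k + 1 + _)%R = k'); last by lia.
by rewrite Hp; lia.
Qed.

(** Labelling both ends of every base by 1 makes consecutive blocks agree where they are glued. The
    neighbours of a glued vertex have labels [rgt + 1] and [lft + 1], which sum to the merged entry;
    this accounts for the 2 added in the merging. *)
Lemma blocks_solution : exists y : int -> nat,
  (forall j, 0 < y j) /\ forall j, c j * y j = y (j - 1)%R + y (j + 1)%R.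
Proof.
have [Hp Hm Hi] := Hb.
pose lb k := 1 :: labels (t k) 1 1.
have size_lb k : size (lb k) = (size (inn (t k))).+1 by rewrite /= size_labels.
have /choice[f Hf] j : exists ki : int * nat,
    ki.2 <= size (inn (t ki.1)) /\ j = (p ki.1 + ki.2%:Z)%R.
  by have [k [i le_i ->]] := blocks_cover j; exists (k, i).
pose y j := nth 0 (lb (f j).1) (f j).2.
have yE k i : i <= size (inn (t k)) -> y (p k + i%:Z)%R = nth 0 (lb k) i.
  move=> le_i; rewrite /y; have [le_f Ef] := Hf (p k + i%:Z)%R.
  by have [<- <-] := blocks_unique le_i le_f Ef.
have yp k : y (p k) = 1 by rewrite -[p k]addr0 (yE k 0).
have yB k : y (p k - 1)%R = rgt (t (k - 1)%R) + 1.
  have := Hp (k - 1)%R; rewrite subrK => ->.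
  rewrite (_ : (_ - 1)%R = p (k - 1)%R + (size (inn (t (k - 1)%R)))%:Z)%R; last by lia.
  rewrite yE // -(size_labels _ 1 1) -[size _]/((size (lb (k - 1)%R)).-1) nth_last /=.
  by rewrite last_labels muln1.
have yS k i : i <= size (inn (t k)) ->
    y (p k + i.+1%:Z)%R = nth 0 (rcons (labels (t k) 1 1) 1) i.
  move=> le_i; rewrite nth_rcons size_labels.
  case: (ltngtP i (size (inn (t k)))) le_i => // [lti _|-> _]; first by rewrite yE.
  by rewrite -Hp yp.
exists y; split=> j; have [k [i le_i ->]] := blocks_cover j.
  rewrite yE // /lb; case: i le_i => //= i lti.
  by rewrite (allP (labels_gt0 (t k) (leqnn 1) (leqnn 1))) // mem_nth ?size_labels.
case: i le_i => [|i] lti.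
  rewrite addr0 yp Hm yB (yS k 0) // muln1.
  rewrite -[nth _ _ 0]/(head 0 (rcons (labels (t k) 1 1) 1)) headI /= head_labels; lia.
rewrite Hi // yE //= (nth_harmonic (harmonic_labels (t k) 1 1)) //.
rewrite (_ : (_ - 1)%R = p k + i%:Z)%R; last by lia.
rewrite (_ : (_ + 1)%R = p k + i.+2%:Z)%R; last by lia.
by rewrite yE ?yS // ltnW.
Qed.

End Blocks.

(** * Short words forced in an affine sequence *)

(* The words occurring around a triangle of depth three when there is none deeper,
   read in one of the two directions. *)
Definition core s := [||
  [&& 2 < size s, take 2 s == [:: 1; 2] & nth 0 s 2 <= 3],
  [&& 3 < size s, take 3 s == [:: 1; 2; 4] & nth 0 s 3 == 1],
  [&& 2 < size s, take 2 (behead s) == [:: 1; 2] & nth 0 s 0 <= 5] |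
  [&& 3 < size s, take 3 s == [:: 1; 3; 1] & nth 0 s 3 <= 5]].

Lemma core_cat s u : core s -> core (s ++ u).
Proof.
case: s => [|a [|b [|d [|e s]]]] //; rewrite /core /= ?take0 ?andbF ?orbF //.
by case/orP => [|] ->; rewrite ?orbT.
Qed.

Definition has_core t :=
  exists s1 s2, inn t = s1 ++ s2 /\ (core s2 \/ core (rev s1)).

Definition ear := Node Leaf Leaf.

(** The trees of depth at most two. *)
Definition small t := [\/ t = Leaf, t = ear |
  [\/ t = Node ear Leaf, t = Node Leaf ear | t = Node ear ear]].

Lemma has_core_test t i :
  core (drop i (inn t)) || core (rev (take i (inn t))) -> has_core t.
Proof.
exists (take i (inn t)), (drop i (inn t)); rewrite cat_take_drop.
by split=> //; apply/orP.
Qed.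

(** A core word of a subtree survives in the tree: [inn] of the left and right subtrees is a prefix
    and a suffix, and [core] tests only an initial segment. So only nodes with two small subtrees
    have to be inspected. *)
Lemma small_or_core t : small t \/ has_core t.
Proof.
elim: t => [|l IHl r IHr]; first by left; constructor 1.
case: IHl => [Sl|[s1 [s2 [E Hs]]]]; last first.
  right; exists s1, (s2 ++ (rgt l + lft r).+1 :: inn r); rewrite /= E -catA; split=> //.
  by case: Hs => ?; [left; apply: core_cat | right].
case: IHr => [Sr|[s1 [s2 [E Hs]]]]; last first.
  right; exists (inn l ++ (rgt l + lft r).+1 :: s1), s2; rewrite /= E -catA; split=> //.
  by case: Hs => ?; [left | right; rewrite rev_cat rev_cons cat_rcons; apply: core_cat].
pose small_test u := match u with
  | Leaf | Node Leaf Leaf | Node (Node Leaf Leaf) Leaf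
  | Node Leaf (Node Leaf Leaf) | Node (Node Leaf Leaf) (Node Leaf Leaf) => true
  | _ => false end.
have smallP u : small_test u -> small u.
  case: u => [|[|[|? ?] [|? ?]] [|[|? ?] [|? ?]]] // _.
  - by constructor 1.
  - by constructor 2.
  - by constructor 3; constructor 2.
  - by constructor 3; constructor 1.
  - by constructor 3; constructor 3.
(* Two small subtrees give at most seven inner vertices, hence at most eight places to cut. *)
suff: small_test (Node l r) || has (fun i => core (drop i (inn (Node l r))) ||
    core (rev (take i (inn (Node l r))))) (iota 0 8).
  by case/orP => [/smallP|/hasP[i _ /has_core_test]]; [left | right].
by case: Sl => [->|->|[->|->|->]]; case: Sr => [->|->|[->|->|->]]; vm_compute.
Qed.

(** The first two cases and the first of the last group cover the [core] words; the others occur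
    where small trees are glued. Each small tree adds at most 2 to a merged entry, whence the global
    bound 6, which controls the unknown neighbour of the word 1, 2. *)
Definition pattern_at (c : int -> nat) (v : nat -> nat) : Prop :=
  [\/ [/\ v 0 = 1, v 1 = 2 & v 2 <= 3 \/ v 2 = 4 /\ v 3 = 1],
      [/\ v 0 <= 5, v 1 = 1 & v 2 = 2],
      [/\ forall j, c j <= 6, v 0 = 1 & v 1 = 2] |
  [\/ [/\ v 0 = 1, v 1 = 3, v 2 = 1 & v 3 <= 5],
      [/\ v 0 = 1, v 1 = 3, v 2 = 1, v 3 = 6 & v 4 = 1],
      [/\ v 0 = 2, v 1 = 3, v 2 = 1 & 3 <= v 3 <= 4] |
      [/\ v 0 = 1, v 1 = 3, v 2 = 3, v 3 = 1 & 3 <= v 4 <= 4]]].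

Definition has_pattern c := exists k : int,
  pattern_at c (fun i => c (k + i%:Z)%R) \/ pattern_at c (fun i => c (k - i%:Z)%R).

Lemma core_pattern c s (v : nat -> nat) :
  (forall i, i < size s -> v i = nth 0 s i) -> core s -> pattern_at c v.
Proof.
move=> Hv /or4P[] /and3P[szs /eqP E le_s].
- case: s E szs le_s Hv => [|? [|? [|? s]]] //= [-> ->] _ le_s Hv.
  by constructor 1; rewrite (Hv 0) // (Hv 1) //; split=> //; left; rewrite (Hv 2).
- constructor 1.
  rewrite !Hv ?szs ?(ltnW szs) ?(ltnW (ltnW szs)) ?(ltnW (ltnW (ltnW szs))) //.
  case: s E szs le_s {Hv} => [|? [|? [|? [|? ?]]]] //= [-> -> ->] _ /eqP ->.
  by split=> //; right.
- constructor 2; rewrite !Hv ?szs ?(ltnW szs) ?(ltnW (ltnW szs)) //.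
  by case: s E szs le_s {Hv} => [|? [|? [|? ?]]] //= [-> ->].
- constructor 4; constructor 1.
  rewrite !Hv ?szs ?(ltnW szs) ?(ltnW (ltnW szs)) ?(ltnW (ltnW (ltnW szs))) //.
  by case: s E szs le_s {Hv} => [|? [|? [|? [|? ?]]]] //= [-> -> ->].
Qed.

Section Patterns.
Variables (c : int -> nat) (t : int -> tree) (p : int -> int).
Hypothesis Hb : blocks c t p.

Lemma has_core_pattern k : has_core (t k) -> has_pattern c.
Proof.
have [Hp _ Hi] := Hb; case=> s1 [s2 [E [H|H]]].
  exists (p k + (size s1).+1%:Z)%R; left; apply: core_pattern H => i lti.
  rewrite -addrA -PoszD addSn Hi E ?size_cat ?ltn_add2l //.
  by rewrite nth_cat ltnNge leq_addr /= addKn.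
exists (p k + (size s1)%:Z)%R; right; apply: core_pattern H => i.
rewrite size_rev => lti; rewrite nth_rev //.
rewrite (_ : (_ - _)%R = p k + (size s1 - i.+1).+1%:Z)%R; last by lia.
by rewrite Hi E ?size_cat ?nth_cat; [case: ltnP; lia | lia].
Qed.

Hypothesis Hs : forall k, small (t k).

Lemma small_bound j : c j <= 6.
Proof.
have [Hp Hm Hi] := Hb; have [k [[|i] le_i ->]] := blocks_cover Hb j.
  by rewrite addr0 Hm; case: (Hs k) => [->|->|[->|->|->]];
     case: (Hs (k - 1)%R) => [->|->|[->|->|->]].
rewrite Hi //; apply: leq_trans (_ : 3 <= 6) => //.
by case: (Hs k) => [->|->|[->|->|->]]; case: (i) => [|[|[|[|?]]]].
Qed.

Lemma small_inn k i : i < size (inn (t k)) -> forall j, j = (p k + i.+1%:Z)%R ->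
  c j = nth 0 (inn (t k)) i.
Proof. by have [_ _ Hi] := Hb => lti j ->; apply: Hi. Qed.

Lemma small_merge k j : j = p k -> c j = rgt (t (k - 1)%R) + 2 + lft (t k).
Proof. by have [_ Hm _] := Hb => ->; apply: Hm. Qed.

(** Without trees of depth two, only bare edges and ears remain. Bare edges alone give 2, ears alone
    give 4, 1, and a bare edge next to an ear gives an entry 3 beside the 1 of the ear. *)
Lemma small_pattern :
  [\/ forall j, c j = 2,
      forall j, (c j = 4 /\ c (j + 1)%R = 1) \/ (c j = 1 /\ c (j + 1)%R = 4)
    | has_pattern c].
Proof.
have [Hp Hm Hi] := Hb.
have pS (k : int) : p (k + 1)%R = (p k + (size (inn (t k))).+1%:Z)%R := Hp k.
have [[k Ek]|N12] := pselect (exists k, t k = Node ear Leaf).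
  constructor 3; exists (p k + 1)%R; left; constructor 3; split.
  - exact: small_bound.
  - by rewrite (@small_inn k 0) ?Ek //; lia.
  - by rewrite (@small_inn k 1) ?Ek //; lia.
have [[k Ek]|N21] := pselect (exists k, t k = Node Leaf ear).
  constructor 3; exists (p k + 2)%R; right; constructor 3; split.
  - exact: small_bound.
  - by rewrite (@small_inn k 1) ?Ek //; lia.
  - by rewrite (@small_inn k 0) ?Ek //; lia.
have [[k Ek]|N131] := pselect (exists k, t k = Node ear ear).
  have Ep : p (k + 1)%R = (p k + 4)%R by rewrite pS Ek.
  have E0 : c (p k + 1 + 0%:Z)%R = 1 by rewrite (@small_inn k 0) ?Ek //; lia.
  have E1 : c (p k + 1 + 1%:Z)%R = 3 by rewrite (@small_inn k 1) ?Ek //; lia.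
  have E2 : c (p k + 1 + 2%:Z)%R = 1 by rewrite (@small_inn k 2) ?Ek //; lia.
  have E3 : c (p k + 1 + 3%:Z)%R = 4 + lft (t (k + 1)%R).
    by rewrite (@small_merge (k + 1)) ?addrK ?Ek //; lia.
  constructor 3; exists (p k + 1)%R; left; constructor 4.
  case: (Hs (k + 1)%R) => [F|F|[F|F|F]]; rewrite F /= in E3.
  - by constructor 1; split=> //; rewrite E3.
  - by constructor 1; split=> //; rewrite E3.
  - by case: N12; exists (k + 1)%R.
  - by case: N21; exists (k + 1)%R.
  - constructor 2; split=> //.
    by rewrite (@small_inn (k + 1) 0) ?F //; lia.
have Hs2 k : t k = Leaf \/ t k = ear.
  case: (Hs k) => [->|->|[E|E|E]]; [by left|by right| | |].
  - by case: N12; exists k.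
  - by case: N21; exists k.
  - by case: N131; exists k.
have [[k]|Hconst] := pselect (exists k, t k <> t (k + 1)%R).
  have Ck : c (p k) = rgt (t (k - 1)%R) + 2 + lft (t k) by exact: small_merge.
  have Ck1 : c (p (k + 1)%R) = rgt (t k) + 2 + lft (t (k + 1)%R).
    by rewrite (@small_merge (k + 1)) ?addrK.
  have Ck2 : c (p (k + 1 + 1)%R) = rgt (t (k + 1)%R) + 2 + lft (t (k + 1 + 1)%R).
    by rewrite (@small_merge (k + 1 + 1)) ?addrK.
  have Pk1 := pS k; have Pk2 := pS (k + 1)%R; have Pkm := pS (k - 1)%R.
  rewrite subrK in Pkm.
  case: (Hs2 k) => E; case: (Hs2 (k + 1)%R) => E1; rewrite E E1 // => _;
  rewrite ?E ?E1 ?addn0 /= in Ck Ck1 Ck2 Pk1 Pk2.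
  - have L1 : c (p (k + 1) + 1)%R = 1 by rewrite (@small_inn (k + 1) 0) ?E1 //; lia.
    have L2 : 3 <= c (p (k + 1 + 1)%R) <= 4.
      by rewrite Ck2; case: (Hs2 (k + 1 + 1)%R) => ->.
    constructor 3; case: (Hs2 (k - 1)%R) => F; rewrite F /= in Ck Pkm.
      exists (p k); left; constructor 4; constructor 3; split=> //.
      + by rewrite addr0.
      + by rewrite -Pk1 Ck1.
      + by rewrite (_ : (_ + _)%R = p (k + 1) + 1)%R //; lia.
      + by rewrite (_ : (_ + _)%R = p (k + 1 + 1))%R //; lia.
    exists (p k - 1)%R; left; constructor 4; constructor 4; split.
    + by rewrite addr0 (@small_inn (k - 1) 0) ?F //; lia.
    + by rewrite (_ : (_ + _)%R = p k) ?Ck //; lia.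
    + by rewrite (_ : (_ + _)%R = p (k + 1))%R ?Ck1 //; lia.
    + by rewrite (_ : (_ + _)%R = p (k + 1) + 1)%R //; lia.
    + by rewrite (_ : (_ + _)%R = p (k + 1 + 1))%R //; lia.
  - have L1 : c (p k + 1)%R = 1 by rewrite (@small_inn k 0) ?E //; lia.
    have L2 : 3 <= c (p k) <= 4.
      by rewrite Ck; case: (Hs2 (k - 1)%R) => ->.
    have Pk3 := pS (k + 1 + 1)%R.
    constructor 3; case: (Hs2 (k + 1 + 1)%R) => F; rewrite F /= in Ck2 Pk3.
      exists (p (k + 1 + 1)%R); right; constructor 4; constructor 3; split=> //.
      + by rewrite subr0.
      + by rewrite (_ : (_ - _)%R = p (k + 1))%R ?Ck1 //; lia.
      + by rewrite (_ : (_ - _)%R = p k + 1)%R //; lia.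
      + by rewrite (_ : (_ - _)%R = p k)%R //; lia.
    exists (p (k + 1 + 1) + 1)%R; right; constructor 4; constructor 4; split.
    + by rewrite subr0 (@small_inn (k + 1 + 1) 0) ?F //; lia.
    + by rewrite (_ : (_ - _)%R = p (k + 1 + 1))%R ?Ck2 //; lia.
    + by rewrite (_ : (_ - _)%R = p (k + 1))%R ?Ck1 //; lia.
    + by rewrite (_ : (_ - _)%R = p k + 1)%R //; lia.
    + by rewrite (_ : (_ - _)%R = p k)%R //; lia.
have tS (k : int) : t (k + 1)%R = t k.
  by apply/esym; case: (pselect (t k = t (k + 1)%R)) => // ne; case: Hconst; exists k.
have tE k : t k = t 0%R.
  elim/int_ind: k => // n IH; first by rewrite -IH -(tS n); congr t; lia.
  by rewrite -IH -(tS (- n.+1%:Z)%R); congr t; lia.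
have pE (k : int) : p (k + 1)%R = (p k + (size (inn (t 0%R))).+1%:Z)%R by rewrite pS tE.
case: (Hs2 0%R) => E0; rewrite E0 /= in pE.
  constructor 1 => j; have [k [i le_i ->]] := blocks_cover Hb j.
  move: le_i; rewrite tE E0 leqn0 => /eqP ->.
  by rewrite addr0 Hm !tE E0.
have H4 k : c (p k) = 4 by rewrite Hm !tE E0.
have H1 k : c (p k + 1)%R = 1 by rewrite (@small_inn k 0) ?tE ?E0.
constructor 2 => j; have [k [i le_i ->]] := blocks_cover Hb j.
move: le_i; rewrite tE E0; case: i => [|[|i]] //= _; [left | right].
  by rewrite addr0 H4 H1.
by rewrite H1 (_ : (_ + _)%R = p (k + 1))%R // pE; lia.
Qed.

End Patterns.

Lemma affine_pattern c : affine_sequence c ->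
  [\/ forall j, c j = 2,
      forall j, (c j = 4 /\ c (j + 1)%R = 1) \/ (c j = 1 /\ c (j + 1)%R = 4)
    | has_pattern c].
Proof.
move=> /affine_blocks[t [p Hb]].
have [[k Hk]|Hn] := pselect (exists k, has_core (t k)).
  by constructor 3; apply: has_core_pattern Hb k Hk.
apply: (small_pattern Hb) => k; case: (small_or_core (t k)) => // Hk.
by case: Hn; exists k.
Qed.

Lemma affine_solution c : affine_sequence c -> exists y : int -> nat,
  (forall j, 0 < y j) /\ forall j, c j * y j = y (j - 1)%R + y (j + 1)%R.
Proof. by move=> /affine_blocks[t [p /blocks_solution]]. Qed.

(** * Triples of roots of unity *)

Definition expt := (nat * nat * nat)%type.

Definition swape (e : expt) : expt := let: (x, y, z) := e in (z, y, x).

Definition m_condb N x y k :=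
  ~~ (N %| x)%N && (N %| x * k.+1)%N || (N %| x * k + y)%N.

(* Returns [N] when no value exists. *)
Definition mexp N x y := find (m_condb N x y) (iota 0 N).

(** The map [swap \o sigma1] on exponents, the first entry in Horner form; the inner reductions keep
    the unary numbers small. *)
Definition nexte N (e : expt) : expt := let: (x, y, z) := e in
  let m := mexp N x y in
  ((((m * x %% N) + y) * m + z) %% N, (N - (2 * (m * x %% N) + y) %% N) %% N, x)%N.

Definition nextc N (e : expt) := let: (x, y, z) := e in mexp N x y.

Fixpoint cseq N n e :=
  if n is n'.+1 then nextc N e :: cseq N n' (nexte N e) else [::].

Definition rede N (e : expt) : expt := let: (x, y, z) := e in (x %% N, y %% N, z %% N)%N.

Definition scale u (e : expt) : expt := let: (x, y, z) := e in (u * x, u * y, u * z)%N.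

(* [(n, p, b, es)] stands for the triples with exponents in [es] of a primitive
   [n]-th root of unity; [b] is the repeating block and [p] a period of the
   sequence of triples. *)
Definition root_row : Type := (nat * nat * seq nat * seq expt)%type.
Definition order_of (r : root_row) := r.1.1.1.
Definition period_of (r : root_row) := r.1.1.2.
Definition block_of (r : root_row) := r.1.2.
Definition expts_of (r : root_row) := r.2.

Definition root_rows : seq root_row := [::
  (3, 1, [:: 2], [:: (1, 1, 1)]);
  (6, 6, [:: 2], [:: (2, 5, 2); (1, 4, 4); (4, 1, 2); (2, 3, 2); (2, 1, 4)]);
  (12, 2, [:: 2], [:: (1, 10, 4)]);
  (5, 2, [:: 1; 4], [:: (1, 4, 4)]);
  (8, 2, [:: 1; 4], [:: (4, 4, 1)]);
  (10, 2, [:: 1; 4], [:: (1, 9, 4)]);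
  (12, 4, [:: 2; 3; 1; 3], [:: (1, 10, 9); (9, 8, 4)]);
  (12, 10, [:: 4; 1; 3; 3; 1], [:: (1, 8, 6); (6, 4, 3); (3, 2, 9); (9, 4, 6); (6, 8, 7)]);
  (18, 4, [:: 6; 1; 3; 1], [:: (1, 12, 9); (9, 6, 4)])]%N.

Definition row_expts (r : root_row) := expts_of r ++ map swape (expts_of r).

(* The exponents [e] of a primitive [N]-th root describe a triple of the row [r], up
   to [swap] and the choice of the primitive root. *)
Definition in_row N (r : root_row) (e : expt) :=
  (order_of r %| N)%N && has (fun u => coprime u (order_of r) &&
    has (fun e' => rede N (scale (u * (N %/ order_of r)) e') == rede N e) (row_expts r))
  (iota 0 (order_of r)).

Definition row_check (r : root_row) :=
  let n := order_of r in let p := period_of r in let b := block_of r in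
  (p %% size b == 0)%N && all (fun e =>
    [&& iter p (nexte n) e == e,
        all (fun i => in_row n r (iter i (nexte n) e)) (iota 0 p) &
        has (fun i => let s := cseq n p (iter i (nexte n) e) in
          all (fun j => nth 0%N s j == nth 0%N b (j %% size b)%N) (iota 0 p)) (iota 0 p)])
  (row_expts r).

Lemma rows_check : all row_check root_rows.
Proof. by vm_compute. Qed.

(* The continuants of [W] are computed by [x' = c x - x_prev] from
   [(x_prev, x) = (a, b)]; truncated subtraction is harmless because the
   comparison comes first. *)
Fixpoint dead (a b : nat) (W : seq nat) : bool :=
  if W is c :: W' then if (c * b <= a)%N then true else dead b (c * b - a) W' else false.

(** Running the swapped triple forwards yields the earlier values backwards, by [chain_reverse]; so
    the entry at index [n] belongs to the triple itself. *)
Definition simw N n e := rev (cseq N n (swape e)) ++ cseq N n e.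

(* The word condition [wp] is tested on the values around the triple; a triple that
   satisfies it must be excluded or listed. Nested [if]s rather than boolean
   connectives, because [vm_compute] is eager. *)
Definition resolved N (wp : pred (seq nat)) (bounded : bool) e :=
  if wp (simw N 4 e) then
    let W := simw N 12 e in
    if has (leq N) W then true else if bounded && has (ltn 6) W then true else
    if dead 0 1 W then true else has (in_row N ^~ e) root_rows
  else true.

Definition check N (filt : pred nat) (g : nat -> nat -> expt) wp bounded :=
  all (fun i => if filt i then all (fun j => resolved N wp bounded (rede N (g i j))) (iota 0 N)
                else true) (iota 0 N).

(* In the next six predicates the [i]-th entry of the window is [c (k + i - 4)], where
   [k] is the place of the triple under consideration. *)
Definition starts_12 : pred (seq nat) := fun W =>
  [&& nth 0 W 3 == 1, nth 0 W 4 == 2 &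
   (nth 0 W 5 <= 3) || (nth 0 W 5 == 4) && (nth 0 W 6 == 1)].
Definition ends_12 n : pred (seq nat) := fun W =>
  [&& nth 0 W 2 <= n, nth 0 W 3 == 1 & nth 0 W 4 == 2].
Definition around_131 : pred (seq nat) := fun W =>
  [&& nth 0 W 3 == 1, nth 0 W 4 == 3, nth 0 W 5 == 1 &
   (nth 0 W 6 <= 5) || (nth 0 W 6 == 6) && (nth 0 W 7 == 1)].
Definition around_31 : pred (seq nat) := fun W =>
  [&& (nth 0 W 3 == 2) || (nth 0 W 3 == 3) && (nth 0 W 2 == 1), nth 0 W 4 == 3,
   nth 0 W 5 == 1 & 3 <= nth 0 W 6 <= 4].
Definition all_2 : pred (seq nat) := pred1 (nseq 8 2).
Definition all_14 : pred (seq nat) := pred1 [:: 4; 1; 4; 1; 4; 1; 4; 1].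

(** Keeps the exponents [i] of d-th roots of unity. With d = 1 only i = 0 is left, which serves the
    normal forms in one unknown. *)
Definition dvd_multiple N d : pred nat := fun i => N %| d * i.

(** Normal forms reached by the lemmas on words, in terms of w^i and w^j: the factor [N.-1] inverts,
    and [N %/ 2] is the exponent of -1. *)
Definition expt_opp N i j : expt := (i, j, N %/ 2).
Definition expt_131 N (i j : nat) : expt := (j, N.-1 * (3 * j), N %/ 2).
Definition expt_inv N i j : expt := (i, j, N.-1 * j).
Definition expt_31 N i j : expt := (i, j, i + N.-1 * (2 * j)).
Definition expt_31_opp N i j : expt := (i, j, N %/ 2 + (3 * i + N.-1 * (3 * j))).
Definition expt_2_mixed N i j : expt := (j, N.-1 * (2 * j), i).
Definition expt_2_eq (N i j : nat) : expt := (i, j, i).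
Definition expt_2_sqr (N i j : nat) : expt := (i, j, 2 * i).
Definition expt_14 N (i j : nat) : expt := (j, N.-1 * (4 * j), N %/ 2).

Definition checks d g wp bounded Ns :=
  all (fun N => check N (dvd_multiple N d) (g N) wp bounded) Ns.

(** For m = [c (k + 1)] = 2, 3, 4 the two alternatives give 12(m + 1) and 12m - 6. *)
Lemma check_12l : checks 3 expt_opp starts_12 false [:: 36; 48; 60; 18; 30; 42].
Proof. by vm_compute. Qed.

(** For m = [c (k - 2)] = 3, 4, 5 the two alternatives give 6(m + 1) and 6(m - 1); [check_12b] is m
    = 6. *)
Lemma check_12r : checks 3 expt_opp (ends_12 5) false [:: 24; 30; 36; 12; 18; 24].
Proof. by vm_compute. Qed.

Lemma check_12b : checks 3 expt_opp (ends_12 6) true [:: 42; 30].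
Proof. by vm_compute. Qed.

(** The moduli are 4m - 6 and 4(m + 1) for m = [c (k + 2)] = 2, ..., 6. *)
Lemma check_131_family :
  checks 1 expt_131 around_131 false [:: 2; 6; 10; 14; 18; 12; 16; 20; 24; 28].
Proof. by vm_compute. Qed.

Lemma check_131_inv : checks 4 expt_inv around_131 false [:: 8].
Proof. by vm_compute. Qed.

Lemma check_131_opp : checks 4 expt_opp around_131 false [:: 8; 12].
Proof. by vm_compute. Qed.

(** Here and in [check_31_b] the moduli belong, in this order, to z^3 = 1, z^4 = 1, z^2 y = 1 and
    z^3 y = 1. *)
Lemma check_31_a : checks 4 expt_31 around_31 false [:: 24; 32; 12; 20].
Proof. by vm_compute. Qed.

Lemma check_31_b : checks 4 expt_31_opp around_31 false [:: 36; 48; 20; 32].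
Proof. by vm_compute. Qed.

Lemma check_2_mixed : checks 3 expt_2_mixed all_2 false [:: 9; 12].
Proof. by vm_compute. Qed.

Lemma check_2_eq : checks 3 expt_2_eq all_2 false [:: 6; 9].
Proof. by vm_compute. Qed.

Lemma check_2_inv : checks 3 expt_2_sqr all_2 false [:: 6; 9].
Proof. by vm_compute. Qed.

Lemma check_14_family : checks 1 expt_14 all_14 false [:: 30; 8].
Proof. by vm_compute. Qed.

Lemma check_14_inv : checks 5 expt_inv all_14 false [:: 30].
Proof. by vm_compute. Qed.

Lemma check_14_opp : checks 5 expt_opp all_14 false [:: 40; 30].
Proof. by vm_compute. Qed.

Local Open Scope ring_scope.
Local Open Scope complex_scope.

(** * Chains of reflections *)

Section Chain.
Variable R : realType.
Implicit Types (x y z w : R[i]) (t : triple R) (T : int -> triple R) (c : int -> nat).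

Lemma m_condE x y k :
  m_cond x y k <-> (x != 1 /\ x ^+ k.+1 = 1) \/ x ^+ k * y = 1.
Proof.
rewrite /m_cond; split=> -[H|H]; try by right.
  left; split; last by apply/eqP; rewrite -subr_eq0 subrX1 H mulr0.
  apply/eqP => x1; move: H; rewrite x1; under eq_bigr do rewrite expr1n.
  by move/eqP; rewrite sumr_const card_ord pnatr_eq0.
left; case: H => x1 /eqP; rewrite -subr_eq0 subrX1 mulf_eq0 subr_eq0 (negbTE x1).
by move/eqP.
Qed.

Lemma is_m_unique x y m m' : is_m x y m -> is_m x y m' -> m = m'.
Proof. by case=> H1 H2 [H3 H4]; apply/eqP; rewrite eqn_leq H2 // H4. Qed.

(** Reflecting back thus uses the same [m], so a chain can be run in both directions. For
    minimality, a new value k < m would give x^(2m-k) y = 1, and the condition at m turns this into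
    a smaller value for the original pair. *)
Lemma is_m_reflect x y m : x != 0 -> y != 0 ->
  is_m x y m -> is_m x (x ^- (2 * m)%N * y^-1) m.
Proof.
move=> x0 y0 [/m_condE Hm min_m].
have xX k : x ^+ k \is a GRing.unit by rewrite unitfE expf_neq0.
split=> [|k /m_condE Hk].
  apply/m_condE; case: Hm => [|E]; [by left | right].
  rewrite mul2n -addnn exprD invfM !mulrA divff ?expf_neq0 // mul1r.
  by rewrite -invfM E invr1.
case: Hk => [Hk|Hk]; first by apply: min_m; apply/m_condE; left.
case: (leqP m k) => // ltkm.
have {}Hk : x ^+ (2 * m - k) * y = 1.
  move: Hk; rewrite (_ : 2 * m = k + (2 * m - k))%N; last by lia.
  rewrite addKn exprD invfM !mulrA divff ?expf_neq0 // mul1r -invfM => E.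
  by rewrite -[LHS]invrK E invr1.
case: Hm => [[x1 E]|E].
  suff : m_cond x y (m.-1 - k)%N by move/min_m; lia.
  apply/m_condE; right; rewrite -Hk.
  by rewrite (_ : 2 * m - k = m.+1 + (m.-1 - k))%N ?exprD ?E ?mul1r //; lia.
have xk : x ^+ (m - k) = 1.
  by rewrite -Hk (_ : 2 * m - k = (m - k) + m)%N ?exprD -?mulrA ?E ?mulr1 //; lia.
case: (eqVneq x 1) => [x1|x1].
  suff : m_cond x y 0 by move/min_m; lia.
  by apply/m_condE; right; rewrite -E x1 !expr1n.
suff : m_cond x y (m - k).-1 by move/min_m; lia.
by apply/m_condE; left; rewrite prednK ?subn_gt0.
Qed.

Definition nonzero t := let: (x, y, z) := t in [&& x != 0, y != 0 & z != 0].

Lemma swapK : involutive (@swap R).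
Proof. by case=> [[]]. Qed.

Lemma nonzero_swap t : nonzero (swap t) = nonzero t.
Proof. by case: t => [[x y] z] /=; do 3!case: (_ == 0). Qed.

Lemma nonzero_sigma1 m t : nonzero t -> nonzero (sigma1 m t).
Proof.
by case: t => [[x y] z] /= /and3P[x0 y0 z0]; rewrite x0 !mulf_neq0 ?invr_neq0 ?expf_neq0.
Qed.

Lemma sigma1K m t : nonzero t -> sigma1 m (sigma1 m t) = t.
Proof.
case: t => [[x y] z] /= /and3P[x0 y0 z0]; congr (_, _, _).
  by rewrite invfM !invrK mulrA mulVf ?mul1r ?expf_neq0.
rewrite exprMn !exprVn -exprM (_ : 2 * m * m = m ^ 2 + m ^ 2)%N; last by lia.
rewrite exprD invfM; set a := x ^+ (m ^ 2); set b := y ^+ m.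
have a0 : a != 0 by rewrite expf_neq0.
have b0 : b != 0 by rewrite expf_neq0.
by field; rewrite a0 b0.
Qed.

Lemma sigma2E m t : sigma2 m t = swap (sigma1 m (swap t)).
Proof. by case: t => [[x y] z] /=; congr (_, _, _); rewrite mulrC [x * _]mulrC mulrA. Qed.

Lemma is_m2E t m : is_m2 t m = is_m1 (swap t) m.
Proof. by case: t => [[]]. Qed.

Lemma is_m1_sigma1 m t : nonzero t -> is_m1 t m -> is_m1 (sigma1 m t) m.
Proof. by case: t => [[x y] z] /= /and3P[x0 y0 z0]; apply: is_m_reflect. Qed.

(* The characteristic sequence with the two simple reflections interchanged at
   odd places, so that every step is [swap \o sigma1]. *)
Definition chain T c := [/\ forall j, nonzero (T j),
  forall j, T (j + 1) = swap (sigma1 (c j) (T j)),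
  forall j, is_m1 (T j) (c j) & forall j, is_m2 (T (j + 1)) (c j)].

Lemma characteristic_chain t c : nonzero t -> characteristic_sequence t c ->
  exists2 T, chain T c & T 0 = t.
Proof.
move=> t0 [Q [Q0 Qf Qb]].
pose T j := if odd `|j|%N then swap (Q j) else Q j.
have oddS (j : int) : odd `|(j + 1)%R|%N = ~~ odd `|j|%N by lia.
have fwd j : 0 <= j -> T (j + 1) = swap (sigma1 (c j) (T j)) /\ is_m1 (T j) (c j).
  move=> /Qf; rewrite /step /T oddS; case: ifP => /= _ [Hm ->].
    by rewrite sigma2E -is_m2E.
  by [].
have bwd j : j < 0 -> T j = sigma1 (c j) (swap (T (j + 1))) /\ is_m1 (swap (T (j + 1))) (c j).
  move=> /Qb; rewrite /step /T oddS; case: ifP => /= _ [Hm ->].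
    by rewrite sigma2E swapK -is_m2E.
  by rewrite swapK.
have nzT j : nonzero (T j).
  elim/int_ind: j => [|n IH|n IH].
  - by rewrite /T /= Q0.
  - have [|E _] := fwd n; first by [].
    by rewrite (_ : n.+1 = n + 1 :> int) ?E ?nonzero_swap ?nonzero_sigma1 //; lia.
  - have [|E _] := bwd (- n.+1%:Z); first by lia.
    rewrite E nonzero_sigma1 // nonzero_swap.
    by rewrite (_ : - n.+1%:Z + 1 = - n%:Z) //; lia.
have nzS j : nonzero (swap (T j)) by rewrite nonzero_swap.
exists T => //.
(* On the negative side the given step leads from [j + 1] to [j]; the involution turns it around. *)
have step j : T (j + 1) = swap (sigma1 (c j) (T j)) /\ is_m1 (T j) (c j).
  have [/fwd//|/bwd[E Hm]] := leP 0 j.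
  by rewrite E sigma1K // swapK; split=> //; apply: is_m1_sigma1.
split=> // j; have [E Hm] := step j => //.
by rewrite E is_m2E swapK; apply: is_m1_sigma1.
Qed.

Lemma chain_prev T c j : chain T c -> T j = sigma1 (c j) (swap (T (j + 1))).
Proof. by case=> nz E _ _; rewrite E swapK sigma1K. Qed.

(** [c j] sits between the places [j] and [j + 1], hence the shift by one. *)
Lemma chain_reverse T c :
  chain T c -> chain (fun j => swap (T (- j))) (fun j => c (- j - 1)).
Proof.
move=> HT; have [nz E H1 H2] := HT; split=> j.
- by rewrite nonzero_swap.
- rewrite opprD (chain_prev (- j - 1) HT).
  by rewrite (_ : - j - 1 + 1 = - j) //; lia.
- rewrite -is_m2E; have := H2 (- j - 1).
  by rewrite (_ : - j - 1 + 1 = - j) //; lia.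
- by rewrite is_m2E swapK opprD.
Qed.

Lemma chain_unique T c i j : chain T c -> T i = T j -> c i = c j.
Proof.
case=> _ _ H1 _ E; have := H1 i; have := H1 j; rewrite E.
by case: (T j) => [[x y] z] /= Hj Hi; apply: is_m_unique Hi Hj.
Qed.

(** A triple determines the values on both sides of it, so a single repetition propagates in both
    directions. *)
Lemma chain_periodic T c (k p : int) :
  chain T c -> T (k + p) = T k -> forall j, T (j + p) = T j.
Proof.
move=> HT E j; have [_ ET _ H2] := HT.
have -> : j = k + (j - k) by lia.
elim/int_ind: (j - k) => [|n IH|n IH]; first by rewrite addr0.
- rewrite (_ : k + n.+1%:Z + p = k + n%:Z + p + 1); last by lia.
  rewrite (_ : k + n.+1%:Z = (k + n%:Z) + 1) ?ET; last by lia.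
  by rewrite IH (chain_unique HT IH).
- have Ea : k - n.+1%:Z + 1 = k - n%:Z by lia.
  have Eb : k - n.+1%:Z + p + 1 = k - n%:Z + p by lia.
  rewrite (chain_prev _ HT) [RHS](chain_prev _ HT) Ea Eb IH; congr (sigma1 _ _).
  have := H2 (k - n.+1%:Z + p); have := H2 (k - n.+1%:Z); rewrite Ea Eb IH.
  by case: (T (k - n%:Z)) => [[x y] z] /= Ha Hb; apply: is_m_unique Hb Ha.
Qed.

End Chain.

(** * Windows of the sequence and positivity of their continuants *)

Definition window (c : int -> nat) (k : int) (n : nat) :=
  [seq c (k + i%:Z) | i <- iota 0 n].

Lemma window_cons c k n : window c k n.+1 = c k :: window c (k + 1) n.
Proof.
rewrite /window /= addr0; congr (_ :: _).
rewrite -[1%N]addn0 iotaDl -map_comp; apply: eq_map => i /=.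
by rewrite -addrA -PoszD.
Qed.

Lemma size_window c k n : size (window c k n) = n.
Proof. by rewrite size_map size_iota. Qed.

Lemma nth_window c k n i : (i < n)%N -> nth 0%N (window c k n) i = c (k + i%:Z).
Proof. by move=> lti; rewrite (nth_map 0%N) ?size_iota // nth_iota. Qed.

Lemma window_cat c k m n : window c k (m + n) = window c k m ++ window c (k + m%:Z) n.
Proof.
rewrite /window iotaD map_cat add0n -{2}[m]addn0 iotaDl -map_comp.
by congr (_ ++ _); apply: eq_map => i /=; rewrite -addrA -PoszD.
Qed.

Section Dead.
Variables (c y : int -> nat).
Hypothesis y_gt0 : forall j, (0 < y j)%N.
Hypothesis cy : forall j, (c j * y j = y (j - 1) + y (j + 1))%N.

(** [s] is the Casoratian of the solution [y] and the sequence of continuants. It is constant along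
    the recursion, and its positivity forces a < c b at every step. *)
Lemma not_dead_from k n a b s : (0 < s)%N -> (b * y (k - 1) = a * y k + s)%N ->
  ~~ dead a b (window c k n).
Proof.
elim: n k a b => [|n IH] k a b s0 E //; rewrite window_cons /=.
have yk := y_gt0 k; have yk1 := y_gt0 (k + 1).
have E2 : (c k * b * y k = a * y k + s + b * y (k + 1))%N.
  by rewrite -E mulnAC cy mulnDl mulnC [(y (k + 1)%R * b)%N]mulnC.
have lt_a : (a < c k * b)%N.
  by rewrite -(ltn_pmul2r yk) E2; lia.
rewrite leqNgt lt_a /=; apply: (IH (k + 1)) s0 _.
by rewrite addrK mulnBl E2; lia.
Qed.

Lemma not_dead k n : ~~ dead 0 1 (window c k n).
Proof. by apply: (@not_dead_from k n 0 1 (y (k - 1))); rewrite ?mul1n. Qed.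

End Dead.

Section Simulation.
Variables (R : realType) (N : nat) (w : R[i]).
Hypothesis w_prim : N.-primitive_root w.

Definition pw (u : R[i]) (e : expt) : triple R :=
  let: (x, y, z) := e in (u ^+ x, u ^+ y, u ^+ z).

Lemma m_condbP x y k : m_cond (w ^+ x) (w ^+ y) k <-> m_condb N x y k.
Proof.
rewrite m_condE /m_condb -!exprM -exprD; rewrite !(prim_order_dvd w_prim).
split=> [[[-> ->]|->]|/orP[/andP[H /eqP E]|/eqP]]; rewrite ?eqxx ?orbT //.
- by left.
- by right.
Qed.

(** A search below [N] is enough: if w^x = 1, the condition does not depend on the exponent and the
    minimum is 0; otherwise N - 1 is a value. *)
Lemma mexpP x y m : is_m (w ^+ x) (w ^+ y) m -> mexp N x y = m /\ (m < N)%N.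
Proof.
case=> /m_condbP Hm min_m; have N0 := prim_order_gt0 w_prim.
have ltmN : (m < N)%N.
  have [Nx|Nx] := boolP (N %| x)%N.
    suff /min_m : m_cond (w ^+ x) (w ^+ y) 0 by rewrite leqn0 => /eqP ->.
    apply/m_condbP; move: Hm; rewrite /m_condb Nx /= muln0 add0n.
    by rewrite dvdn_addr // dvdn_mulr.
  suff /min_m : m_cond (w ^+ x) (w ^+ y) N.-1 by lia.
  by apply/m_condbP; rewrite /m_condb Nx prednK // dvdn_mull.
split=> //; rewrite /mexp; set p := m_condb N x y.
have hasp : has p (iota 0 N) by apply/hasP; exists m; rewrite ?mem_iota.
have ltf : (find p (iota 0 N) < N)%N by rewrite -[X in (_ < X)%N](size_iota 0 N) -has_find.
have := nth_find 0%N hasp; rewrite nth_iota // add0n => /m_condbP/min_m le_m.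
apply/eqP; rewrite eqn_leq le_m andbT leqNgt; apply/negP => /(before_find 0%N).
by rewrite nth_iota // add0n /p Hm.
Qed.

Lemma prim_neq0 : w != 0.
Proof.
by rewrite (prim_root_eq0 w_prim) gtn_eqF // (prim_order_gt0 w_prim).
Qed.

Lemma pw_rede e : pw w (rede N e) = pw w e.
Proof. by case: e => [[x y] z] /=; rewrite !(prim_expr_mod w_prim). Qed.

Lemma pw_swape u e : pw u (swape e) = swap (pw u e).
Proof. by case: e => [[]]. Qed.

Lemma pw_nexte e m : is_m1 (pw w e) m ->
  nextc N e = m /\ swap (sigma1 m (pw w e)) = pw w (nexte N e).
Proof.
case: e => [[x y] z] /= /mexpP[-> ltm]; split=> //.
have Ex : w ^+ (m * x %% N) = (w ^+ x) ^+ m.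
  by rewrite (prim_expr_mod w_prim) mulnC exprM.
congr (_, _, _).
  by rewrite (prim_expr_mod w_prim) -mulnn exprD !exprM exprD Ex exprMn.
rewrite (prim_expr_mod w_prim) -invfM; set s := (_ %% N)%N.
have les : (s <= N)%N by rewrite ltnW // ltn_mod (prim_order_gt0 w_prim).
have -> : (w ^+ x) ^+ (2 * m) * w ^+ y = w ^+ s.
  rewrite /s (prim_expr_mod w_prim) (exprD w); congr (_ * _).
  by rewrite mulnC (exprM (w ^+ x)) -Ex -exprM mulnC.
have ws : w ^+ s != 0 by rewrite expf_neq0 // prim_neq0.
by apply: (mulIf ws); rewrite mulVf // -exprD subnK // (prim_expr_order w_prim).
Qed.

Lemma sim_state T c k e i : chain T c -> T k = pw w e ->
  T (k + i%:Z) = pw w (iter i (nexte N) e).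
Proof.
move=> HT Ek; have [_ ET H1 _] := HT; elim: i => [|i IH]; first by rewrite addr0.
rewrite (_ : k + i.+1%:Z = k + i%:Z + 1); last by lia.
have := H1 (k + i%:Z); rewrite ET IH => /pw_nexte[_ ->].
by rewrite iterS.
Qed.

Lemma sim_window T c k e n : chain T c -> T k = pw w e -> window c k n = cseq N n e.
Proof.
move=> HT; have [_ ET H1 _] := HT; elim: n k e => [|n IH] k e Ek //.
have := H1 k; rewrite Ek => /pw_nexte[Ec E].
by rewrite window_cons /= Ec (IH _ (nexte N e)) // ET Ek E.
Qed.

Lemma sim_lt T c k e i : chain T c -> T k = pw w e -> (c (k + i%:Z)%R < N)%N.
Proof.
move=> HT Ek; have [_ _ H1 _] := HT; have := H1 (k + i%:Z).
rewrite (sim_state i HT Ek); case: (iter _ _ _) => [[x y] z] /=.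
by case/mexpP.
Qed.

End Simulation.

Lemma pw_scale (R : realType) (w : R[i]) u e : pw w (scale u e) = pw (w ^+ u) e.
Proof. by case: e => [[x y] z] /=; rewrite !exprM. Qed.

Lemma in_rowP (R : realType) N (w : R[i]) r e : N.-primitive_root w -> in_row N r e ->
  exists (z : R[i]) e', [/\ (order_of r).-primitive_root z, e' \in row_expts r &
    pw w e = pw z e'].
Proof.
move=> w_prim /andP[dvN /hasP[u _ /andP[cop /hasP[e' e'_in /eqP E]]]].
have N0 := prim_order_gt0 w_prim; have n0 := dvdn_gt0 N0 dvN.
exists ((w ^+ (N %/ order_of r)) ^+ u), e'; split=> //.
  by rewrite prim_root_exp_coprime //; apply: dvdn_prim_root.
by rewrite -(pw_rede w_prim e) -E (pw_rede w_prim) pw_scale -exprM mulnC.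
Qed.

Section Rows.
Variable R : realType.
Implicit Types (T : int -> triple R) (c : int -> nat).

Definition classified T c := exists b : seq nat,
  (listed (T 0) b \/ listed (swap (T 0)) b) /\ periodic_with_block c b.

Lemma expts_listed r (z : R[i]) e : r \in root_rows -> (order_of r).-primitive_root z ->
  e \in expts_of r -> listed (pw z e) (block_of r).
Proof.
rewrite !inE => /orP[|/orP[|/orP[|/orP[|/orP[|/orP[|/orP[|/orP[]]]]]]]] /eqP -> z_prim;
  rewrite !inE.
- by move/eqP => ->; apply: Row1.
- move=> /or4P[|||/orP[]] /eqP ->.
  + exact: Row2.
  + exact: Row3.
  + by apply: Row4 z_prim _; rewrite !inE eqxx.
  + by apply: Row4 z_prim _; rewrite !inE eqxx orbT.
  + by apply: Row4 z_prim _; rewrite !inE eqxx !orbT.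
- by move/eqP => ->; apply: Row5.
- by move/eqP => ->; apply: Row6.
- by move/eqP => ->; apply: Row7.
- by move/eqP => ->; apply: Row8.
- by case/orP => /eqP ->; apply: Row9 z_prim _; rewrite !inE eqxx ?orbT.
- by move=> /or4P[|||/orP[]] /eqP ->; apply: Row10 z_prim _; rewrite !inE eqxx ?orbT.
- by case/orP => /eqP ->; apply: Row11 z_prim _; rewrite !inE eqxx ?orbT.
Qed.

Lemma row_listed r (z : R[i]) e : r \in root_rows -> (order_of r).-primitive_root z ->
  e \in row_expts r -> listed (pw z e) (block_of r) \/ listed (swap (pw z e)) (block_of r).
Proof.
move=> r_in z_prim; rewrite mem_cat => /orP[e_in|/mapP[e' e'_in ->]].
  by left; apply: expts_listed.
by right; rewrite pw_swape swapK; apply: expts_listed.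
Qed.

(** [rows_check] supplies a period of the triples, the fact that every triple within a period is
    again in the row, which gives [T 0], and an offset [i0] at which the block begins. *)
Lemma row_classified T c k r (z : R[i]) e : chain T c -> r \in root_rows ->
  (order_of r).-primitive_root z -> e \in row_expts r -> T k = pw z e -> classified T c.
Proof.
move=> HT r_in z_prim e_in Ek.
have /andP[/eqP pb /allP/(_ _ e_in)] := allP rows_check _ r_in.
case/and3P => /eqP Ep /allP orb /hasP[i0 _ /allP Hb].
set n := order_of r in z_prim Ep orb Hb; set p := period_of r in pb Ep orb Hb.
set b := block_of r in pb Hb.
have b0 : (0 < size b)%N.
  by move: r_in; rewrite /b /root_rows !inE; do 8?[case/orP]; move/eqP ->.
have p0 : (0 < p)%N.
  by move: r_in; rewrite /p /root_rows !inE; do 8?[case/orP]; move/eqP ->.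
have per : forall j, T (j + p%:Z) = T j.
  by apply: (chain_periodic (k := k) HT); rewrite (sim_state z_prim p HT Ek) Ep.
have perM (q j : int) : T (j + q * p%:Z) = T j.
  elim/int_ind: q => [|q IH|q IH]; first by rewrite mul0r addr0.
    by rewrite -IH -[RHS]per; congr T; rewrite intS; ring.
  by rewrite -IH -[LHS]per; congr T; rewrite intS; ring.
have modp (j : int) : exists2 i, (i < p)%N & exists q : int, j = i%:Z + q * p%:Z.
  exists `|(j %% p%:Z)%Z|%N; last exists (j %/ p%:Z)%Z.
    have := ltz_pmod j (d := p%:Z); have := modz_ge0 j (d := p%:Z); lia.
  rewrite gez0_abs ?modz_ge0 //; last by lia.
  by rewrite addrC -divz_eq.
exists b; split.
  have [i ltip [q Eq]] := modp (- k).
  have -> : T 0 = T (k + i%:Z) by rewrite -[RHS](perM q); congr T; lia.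
  rewrite (sim_state z_prim i HT Ek).
  have /orb/(in_rowP z_prim)[z' [e' [z'_prim e'_in ->]]] : i \in iota 0 p by rewrite mem_iota.
  exact: row_listed z'_prim e'_in.
exists (k + i0%:Z) => j.
have [i ltip [q ->]] := modp j.
rewrite addrA (chain_unique HT (perM q _)).
have E0 := sim_state z_prim i0 HT Ek.
rewrite -(nth_window _ _ ltip) (sim_window z_prim p HT E0).
have /Hb/eqP -> : i \in iota 0 p by rewrite mem_iota.
congr (nth _ _ _).
have /dvdnP[q' ->] : (size b %| p)%N by apply/eqP.
by rewrite PoszM mulrA -modzDmr modzMl addr0 modz_nat absz_nat.
Qed.

End Rows.

(** * Reducing monomial equations to powers of a single root of unity *)

Section RootsOfUnity.
Variable R : realType.
Implicit Types (x y z w : R[i]).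

Lemma prim_root_exists N : (0 < N)%N -> exists w : R[i], N.-primitive_root w.
Proof.
move=> N0; pose p : {poly R[i]} := 'X^N - 1.
have [r Dp] := closed_field_poly_normal p.
rewrite (monicP _) ?monicXnsubC // scale1r in Dp.
have rn1 : all N.-unity_root r by apply/allP=> z; rewrite -root_prod_XsubC -Dp.
have sz_r : (N < (size r).+1)%N.
  by rewrite -(size_prod_XsubC r id) -Dp size_XnsubC.
have [|z] := hasP (has_prim_root N0 rn1 _ sz_r); last by exists z.
by rewrite -separable_prod_XsubC -Dp separable_Xn_sub_1 // pnatr_eq0 -lt0n.
Qed.

Lemma prim_root_half N w : ~~ odd N -> N.-primitive_root w -> w ^+ (N %/ 2) = - 1.
Proof.
move=> evN w_prim; have N0 := prim_order_gt0 w_prim.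
have EN : (N %/ 2 * 2 = N)%N by rewrite divnK // dvdn2.
have : (w ^+ (N %/ 2)) ^+ 2 == 1 by rewrite -exprM EN (prim_expr_order w_prim).
rewrite sqrf_eq1 => /orP[|/eqP //].
rewrite -(prim_order_dvd w_prim) => /dvdn_leq; lia.
Qed.

Lemma root_inv N y : (0 < N)%N -> y ^+ N = 1 -> y^-1 = y ^+ N.-1.
Proof.
move=> N0 yN; have y0 : y != 0.
  by apply/eqP => y0; move/eqP: yN; rewrite y0 expr0n gtn_eqF // eq_sym oner_eq0.
by apply: (mulfI y0); rewrite divff // -exprS prednK.
Qed.

Lemma sqr1_opp x : x != 1 -> x ^+ 2 = 1 -> x = - 1.
Proof. by move=> x1 /eqP; rewrite sqrf_eq1 (negbTE x1) => /eqP. Qed.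

Lemma is_m_cond x y m : is_m x y m -> (x != 1 /\ x ^+ m.+1 = 1) \/ x ^+ m * y = 1.
Proof. by case=> /m_condE. Qed.

Lemma is_m_le x y m k : is_m x y m ->
  (x != 1 /\ x ^+ k.+1 = 1) \/ x ^+ k * y = 1 -> (m <= k)%N.
Proof. by case=> _ H /m_condE /H. Qed.

Lemma common_root N d x y : (0 < N)%N -> (d %| N)%N -> x ^+ d = 1 -> y ^+ N = 1 ->
  exists (w : R[i]) (i j : nat), [/\ N.-primitive_root w, (i < N)%N, (j < N)%N,
    (N %| d * i)%N & x = w ^+ i /\ y = w ^+ j].
Proof.
move=> N0 /dvdnP[q Eq] xd yN; have [w w_prim] := prim_root_exists N0.
have xN : x ^+ N = 1 by rewrite Eq mulnC exprM xd expr1n.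
have [[i lti] /= Ex] := prim_rootP w_prim xN.
have [[j ltj] /= Ey] := prim_rootP w_prim yN.
exists w, i, j; split=> //.
by rewrite (prim_order_dvd w_prim) mulnC exprM -Ex xd.
Qed.

(** The sixth power removes the sign and the cube root of unity at once; this is the source of the
    factor 6 in the moduli for the word 1, 2. *)
Lemma exp6_opp x y e : x ^+ 3 = 1 -> (- x * y ^+ e) ^+ 6 = y ^+ (6 * e).
Proof.
move=> x3; rewrite exprMn -exprM mulnC -[RHS]mul1r; congr (_ * _).
by rewrite (_ : (- x) ^+ 6 = (x ^+ 3) ^+ 2); [rewrite x3 expr1n | ring].
Qed.

Lemma opp_mono_order x y e m : x ^+ 3 = 1 -> (- x * y ^+ e) ^+ m = 1 -> y ^+ (6 * e * m) = 1.
Proof. by move=> x3 H; rewrite exprM -(exp6_opp y e x3) exprAC H expr1n. Qed.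

Lemma opp_mono_eq x y e u m : x ^+ 3 = 1 -> y != 0 -> (0 < e)%N ->
  u ^+ 6 = y ^+ 6 -> (- x * y ^+ e) ^+ m.+1 = u -> y ^+ (6 * e * m.+1 - 6) = 1.
Proof.
move=> x3 y0 e0 Eu H; have y6 : y ^+ 6 != 0 by rewrite expf_neq0.
apply: (mulIf y6); rewrite mul1r -exprD subnK; last by lia.
by rewrite exprM -(exp6_opp y e x3) exprAC H.
Qed.

Lemma prim_inv N w n : N.-primitive_root w -> w ^+ (N.-1 * n) = (w ^+ n)^-1.
Proof.
move=> w_prim; have N0 := prim_order_gt0 w_prim.
rewrite mulnC exprM -(root_inv N0) // exprAC (prim_expr_order w_prim).
exact: expr1n.
Qed.

Lemma is_m1_cond x y : is_m x y 1 -> x = - 1 \/ x * y = 1.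
Proof. by case/is_m_cond => [[x1 /(sqr1_opp x1)]|]; [left | right]. Qed.

End RootsOfUnity.

Definition sporadic (R : realType) (T : int -> triple R) :=
  exists (k : int) (r : root_row) (z : R[i]) (e : expt),
    [/\ r \in root_rows, (order_of r).-primitive_root z, e \in row_expts r & T k = pw z e].

Lemma sporadic_reverse (R : realType) (T : int -> triple R) :
  sporadic (fun j => swap (T (- j))) -> sporadic T.
Proof.
case=> k [r [z [e [r_in z_prim e_in E]]]]; exists (- k), r, z, (swape e); split=> //.
  move: e_in; rewrite /row_expts !mem_cat => /orP[e_in|/mapP[e' e'_in ->]].
    by rewrite map_f ?orbT.
  by case: e' e'_in => [[? ?] ?] /= ->.
by rewrite pw_swape -E swapK.
Qed.

Section Cases.
Variables (R : realType) (T : int -> triple R) (c y_ : int -> nat).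
Hypothesis HT : chain T c.
Hypothesis y_gt0 : forall j, (0 < y_ j)%N.
Hypothesis cy : forall j, (c j * y_ j = y_ (j - 1) + y_ (j + 1))%N.
Implicit Types (x y z w : R[i]) (k : int) (m : nat).

Lemma not_dead3_from k : ~~ dead 0 1 [:: c k; c (k + 1); c (k + 2)].
Proof. by have := not_dead y_gt0 cy k 3; rewrite /window /= addr0. Qed.

Lemma window8 k : window c (k - 4) 8 =
  [:: c (k - 4); c (k - 3); c (k - 2); c (k - 1); c k; c (k + 1); c (k + 2); c (k + 3)].
Proof. by rewrite /window /=; do !congr (_ :: _); congr c; lia. Qed.

Lemma sim_full N w k e n : N.-primitive_root w -> T k = pw w e ->
  window c (k - n%:Z) (n + n) = simw N n e.
Proof.
move=> w_prim Ek; rewrite window_cat subrK /simw -(sim_window w_prim n HT Ek).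
have E' : swap (T (- - k)) = pw w (swape e) by rewrite opprK Ek pw_swape.
rewrite -(sim_window w_prim n (chain_reverse HT) E'); congr (_ ++ _).
apply: (@eq_from_nth _ 0%N); rewrite ?size_rev ?size_window // => i lti.
rewrite nth_rev ?size_window // !nth_window ?size_window //; last by lia.
by congr c; lia.
Qed.

Lemma sim_bound N w k e j : N.-primitive_root w -> T k = pw w e -> (c j < N)%N.
Proof.
move=> w_prim Ek; have [le_kj|lt_jk] := leP k j.
  by have := sim_lt w_prim `|(j - k)%R|%N HT Ek; rewrite (_ : k + _ = j) //; lia.
have E' : swap (T (- - k)) = pw w (swape e) by rewrite opprK Ek pw_swape.
have := sim_lt w_prim `|(k - 1 - j)%R|%N (chain_reverse HT) E'.
by rewrite (_ : - _ - 1 = j) //; lia.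
Qed.

Lemma resolvedP N w e k (wp : pred (seq nat)) (bounded : bool) :
  N.-primitive_root w -> T k = pw w e ->
  (bounded -> forall j, (c j <= 6)%N) -> wp (window c (k - 4) 8) ->
  resolved N wp bounded (rede N e) -> sporadic T.
Proof.
move=> w_prim; rewrite -(pw_rede w_prim) => Ek Hb Hkp.
rewrite /resolved -(sim_full 4 w_prim Ek) -(sim_full 12 w_prim Ek) Hkp.
(* The value [N] of [mexp] means undefined; all values of a chain are smaller. *)
have -> : has (leq N) (window c (k - 12%:Z) (12 + 12)) = false.
  apply/hasP => -[m /(nthP 0%N)[i + <-]]; rewrite size_window => lti.
  by rewrite nth_window // leqNgt (sim_bound _ w_prim Ek).
have -> : bounded && has (ltn 6) (window c (k - 12%:Z) (12 + 12)) = false.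
  case: bounded Hb => // /(_ isT) Hb; rewrite andTb.
  apply/hasP => -[m /(nthP 0%N)[i + <-]]; rewrite size_window => lti.
  by rewrite nth_window //; apply/negP; rewrite -leqNgt; apply: Hb.
rewrite (negbTE (not_dead y_gt0 cy _ _)) => /hasP[r r_in r_row].
have [z [e' [z_prim e'_in E]]] := in_rowP w_prim r_row.
by exists k, r, z, e'; rewrite -E.
Qed.

Lemma chain_facts k x y z : T k = (x, y, z) ->
  [/\ x != 0, y != 0, z != 0, is_m x y (c k) & is_m z y (c (k - 1))].
Proof.
move=> E; have [nz _ H1 H2] := HT; have := nz k; have := H1 k; have := H2 (k - 1).
by rewrite subrK E /= => ? ? /and3P[].
Qed.

Lemma chain_nextE k x y z m : T k = (x, y, z) -> c k = m ->
  T (k + 1) = (x ^+ (m ^ 2)%N * y ^+ m * z, x ^- (2 * m)%N * y^-1, x).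
Proof. by move=> E Ec; have [_ -> _ _] := HT; rewrite E Ec. Qed.

Lemma chain_prevE k x y z m : T k = (x, y, z) -> c (k - 1) = m ->
  T (k - 1) = (z, z ^- (2 * m)%N * y^-1, z ^+ (m ^ 2)%N * y ^+ m * x).
Proof. by move=> E Ec; rewrite (chain_prev _ HT) subrK E Ec. Qed.

Lemma not_dead3 k : ~~ dead 0 1 [:: c (k - 1); c k; c (k + 1)].
Proof.
have := not_dead3_from (k - 1); rewrite subrK.
by rewrite (_ : k - 1 + 2 = k + 1) //; lia.
Qed.

Section CheckP.
Variables (d : nat) (g : nat -> nat -> nat -> expt) (wp : pred (seq nat)).
Variables (bounded : bool) (Ns : seq nat) (N : nat) (k : int).
Hypothesis Hchecks : checks d g wp bounded Ns.
Hypothesis N_in : N \in Ns.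
Hypothesis Hbounded : bounded -> forall j, (c j <= 6)%N.
Hypothesis Hkp : wp (window c (k - 4) 8).

Lemma checkP w i j : N.-primitive_root w -> (i < N)%N -> (j < N)%N ->
  (N %| d * i)%N -> T k = pw w (g N i j) -> sporadic T.
Proof.
move=> w_prim lti ltj dvi Ek.
apply: (resolvedP w_prim Ek Hbounded Hkp).
have /allP/(_ i) := allP Hchecks _ N_in.
rewrite mem_iota /dvd_multiple dvi => /(_ lti)/allP/(_ j); rewrite mem_iota; exact.
Qed.

Lemma check_pair x y (h : R[i] -> R[i] -> triple R) :
  (0 < N)%N -> (d %| N)%N -> x ^+ d = 1 -> y ^+ N = 1 -> T k = h x y ->
  (forall w i j, N.-primitive_root w -> h (w ^+ i) (w ^+ j) = pw w (g N i j)) ->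
  sporadic T.
Proof.
move=> N0 dN xd yN Ek Eh.
have [w [i [j [w_prim lti ltj dvi [Ex Ey]]]]] := common_root N0 dN xd yN.
by apply: (checkP w_prim lti ltj dvi); rewrite Ek Ex Ey Eh.
Qed.

End CheckP.

Lemma check_opp d wp bounded Ns N k x y : checks d expt_opp wp bounded Ns -> N \in Ns ->
  (bounded -> forall j, (c j <= 6)%N) -> wp (window c (k - 4) 8) ->
  (0 < N)%N -> (d %| N)%N -> ~~ odd N -> x ^+ d = 1 -> y ^+ N = 1 ->
  T k = (x, y, - 1) -> sporadic T.
Proof.
move=> Hc HN Hb Hk N0 dN evN xd yN Ek.
apply: (check_pair Hc HN Hb Hk (h := fun x y => (x, y, - 1)) N0 dN xd yN Ek).
by move=> w i j w_prim; rewrite /= (prim_root_half evN w_prim).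
Qed.

(** The alternatives z y = 1 and x^2 y = 1 force [c (k - 2)] <= 2, but a word m, 1, 2 with m <= 2
    has a nonpositive continuant. *)
Lemma chain_12 k : c (k - 1) = 1%N -> c k = 2 ->
  exists x y, [/\ T k = (x, y, - 1), x ^+ 3 = 1 & y != 0].
Proof.
move=> c1 c2; case E : (T k) => [[x y] z].
have [x0 y0 z0 Hx Hz] := chain_facts E; have E1 := chain_prevE E c1.
have [_ _ _ _ H2] := chain_facts E1; rewrite c1 in Hz; rewrite c2 in Hx.
have D := not_dead3 (k - 1); rewrite subrK c1 c2 in D.
have D2 : (c (k - 1 - 1) <= 2)%N -> False.
  by case: (c _) D => [|[|[|?]]].
have /is_m_cond[[z1 z2]|zy] := Hz; last first.
  have H2' : is_m x y (c (k - 1 - 1)).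
    move: H2; have -> : z ^- (2 * 1) * y^-1 = z^-1 ^+ 2 * y^-1 by rewrite exprVn.
    have Ey : y = z^-1 by apply: (mulfI z0); rewrite zy divff.
    rewrite (_ : z ^+ _ * _ * x = x); last by rewrite !expr1 mulrC zy mulr1.
    by rewrite Ey invrK expr2 -mulrA mulVf // mulr1.
  by case: D2; rewrite (is_m_unique H2' Hx).
have Ez := sqr1_opp z1 z2; subst z.
have /is_m_cond[[x1 x3]|xy] := Hx; first by exists x, y.
case: D2; apply: (is_m_le H2); right.
by rewrite -xy; field; rewrite y0 x0.
Qed.

(** The next triple begins with -x y^2, so after a sixth power its equation involves y alone. *)
Lemma pattern_12l k : c (k - 1) = 1%N -> c k = 2 ->
  (c (k + 1) <= 3)%N \/ c (k + 1) = 4 /\ c (k + 2) = 1%N -> sporadic T.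
Proof.
move=> c1 c2 HB; have [x [y [E x3 y0]]] := chain_12 c1 c2.
have Hk : starts_12 (window c (k - 4) 8).
  rewrite window8 /starts_12 /= c1 c2 /=.
  by case: HB => [->|[-> ->]]; rewrite ?orbT.
have le4 : (c (k + 1) <= 4)%N by case: HB => [|[->]] //; lia.
have [x0 _ _ _ _] := chain_facts E.
have [_ _ _ /is_m_cond HBc _] := chain_facts (chain_nextE E c2).
have x4 : x ^+ 4 = x by rewrite exprSr x3 mul1r.
have Ex : x ^+ (2 ^ 2) * y ^+ 2 * -1 = - x * y ^+ 2 by rewrite -[x ^+ _]/(x ^+ 4) x4; ring.
rewrite {}Ex in HBc.
have {HBc} [HB1|HB2] : (- x * y ^+ 2) ^+ (c (k + 1)).+1 = 1 \/
    (- x * y ^+ 2) ^+ c (k + 1) = x * y.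
  case: HBc => [[_ H]|H]; [by left | right].
  move: H; rewrite -[x ^+ (2 * 2)]/(x ^+ 4) x4 -invfM => /(canRL (divfK _)) ->.
    by rewrite mul1r.
  by rewrite mulf_neq0.
- have {HB1} := opp_mono_order x3 HB1.
  have := not_dead3 k; rewrite c1 c2.
  case: (c (k + 1)) le4 => [|[|[|[|[|?]]]]] // _ _ yN;
  exact: (check_opp check_12l _ _ Hk _ _ _ x3 yN E).
- have Eu : (x * y) ^+ 6 = y ^+ 6.
    by rewrite exprMn -[x ^+ 6]/(x ^+ (3 * 2)) exprM x3 expr1n mul1r.
  have := not_dead3 k; rewrite c1 c2.
  case: (c (k + 1)) le4 HB2 => [|[|[|[|[|?]]]]] // _ /(opp_mono_eq (e := 2) x3 y0 isT Eu) yN _;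
  exact: (check_opp check_12l _ _ Hk _ _ _ x3 yN E).
Qed.

Lemma chain_12_left k : c (k - 1) = 1%N -> c k = 2 ->
  exists x y a, [/\ T k = (x, y, - 1), x ^+ 3 = 1, c (k - 2) = a.+3 &
    y ^+ (6 * a.+4) = 1 \/ y ^+ (6 * a.+2) = 1].
Proof.
move=> c1 c2; have [x [y [E x3 y0]]] := chain_12 c1 c2.
have := not_dead3 (k - 1); rewrite subrK c1 c2.
have [_ _ _ _ /is_m_cond] := chain_facts (chain_prevE E c1).
rewrite (_ : k - 1 - 1 = k - 2); last by lia.
have -> : (-1) ^- (2 * 1) * y^-1 = y^-1 by rewrite sqrrN expr1n invr1 mul1r.
have -> : (-1) ^+ (1 ^ 2) * y ^+ 1 * x = - x * y ^+ 1 by rewrite expr1; ring.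
case: (c (k - 2)) => [|[|[|a]]] // H _; exists x, y, a; split=> //.
case: H => [[_ /(opp_mono_order x3)]|/(canRL (divfK y0))]; first by left.
rewrite mul1r => /(opp_mono_eq (e := 1) x3 y0 isT erefl) H; right.
by move: H; congr (_ ^+ _ = _); lia.
Qed.

Lemma pattern_12r k : c (k - 1) = 1%N -> c k = 2 -> (c (k - 2) <= 5)%N -> sporadic T.
Proof.
move=> c1 c2 le5; have [x [y [a [E x3 Ea Hy]]]] := chain_12_left c1 c2.
have Hk : ends_12 5 (window c (k - 4) 8) by rewrite window8 /ends_12 /= c1 c2 le5.
rewrite Ea in le5.
by case: a Hy le5 {Ea} => [|[|[|?]]] // [] yN _;
  exact: (check_opp check_12r _ _ Hk _ _ _ x3 yN E).
Qed.

Lemma pattern_12b k : (forall j, (c j <= 6)%N) -> c (k - 1) = 1%N -> c k = 2 -> sporadic T.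
Proof.
move=> le6 c1 c2; have [le5|gt5] := leqP (c (k - 2)) 5; first exact: pattern_12r le5.
have [x [y [a [E x3 Ea Hy]]]] := chain_12_left c1 c2.
have Hk : ends_12 6 (window c (k - 4) 8) by rewrite window8 /ends_12 /= c1 c2 le6.
have Ea3 : a = 3 by have := le6 (k - 2); rewrite Ea in gt5 *; lia.
by rewrite Ea3 in Hy; case: Hy => yN;
  exact: (check_opp check_12b _ (fun _ => le6) Hk _ _ _ x3 yN E).
Qed.

Lemma pattern_131 k : c (k - 1) = 1%N -> c k = 3 -> c (k + 1) = 1%N ->
  (c (k + 2) <= 5)%N \/ c (k + 2) = 6 /\ c (k + 3) = 1%N -> sporadic T.
Proof.
move=> c1 c3 c1' HB; case E : (T k) => [[x y] z].
have [x0 y0 z0 Hx Hz] := chain_facts E.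
rewrite c3 in Hx; rewrite c1 in Hz.
have Hk : around_131 (window c (k - 4) 8).
  by rewrite window8 /around_131 /= c1 c3 c1' /=; case: HB => [->|[-> ->]]; rewrite ?orbT.
have E1 := chain_nextE E c3; have [_ _ _ Hx1 _] := chain_facts E1; rewrite c1' in Hx1.
have E2 := chain_nextE E1 c1'; have [_ _ _ Hx2 _] := chain_facts E2.
rewrite (_ : k + 1 + 1 = k + 2) in E2 Hx2; last by lia.
have c_after b : c (k + 2) = b -> ~~ dead 0 1 [:: 1%N; 3; 1%N; b].
  move=> <-; have := not_dead y_gt0 cy (k - 1) 4; rewrite /window /= addr0 subrK c1 c3.
  rewrite (_ : k - 1 + 2 = k + 1) ?c1'; last by lia.
  by rewrite (_ : k - 1 + 3 = k + 2) //; lia.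
have le6 : (c (k + 2) <= 6)%N by case: HB => [|[->]] //; lia.
(* The triples would repeat after two steps with values 3, 1, and the word 3, 1, 3, 1, 3 has
   continuant 0. *)
have G2 : x ^+ 3 * y = 1 -> z * y = 1 -> False.
  move=> Exy Ezy.
  have Ey : y = x ^- 3 by apply: (mulfI (expf_neq0 3 x0)); rewrite Exy divff ?expf_neq0.
  have Ez : z = x ^+ 3 by rewrite -[LHS]mulr1 -Exy mulrCA Ezy mulr1.
  have T2 : T (k + 2) = T k.
    by rewrite E2 E Ez Ey; congr (_, _, _); field.
  have c2E : c (k + 2) = 3 by rewrite -c3; apply: chain_unique T2.
  have T3 : T (k + 3) = T (k + 1) by have := chain_periodic HT T2 (k + 1); rewrite -addrA.
  have T4 : T (k + 4) = T k by rewrite -T2 -(chain_periodic HT T2 (k + 2)) -addrA.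
  have := not_dead y_gt0 cy k 5.
  rewrite /window /= addr0 c3 c1' c2E (chain_unique HT T3) (chain_unique HT T4).
  by rewrite c1' c3.
have [Exy|[x1 x4]] : x ^+ 3 * y = 1 \/ x != 1 /\ x ^+ 4 = 1.
- by case/is_m_cond: Hx => [[]|]; [right | left].
- have [Ez|/(G2 Exy)//] := is_m1_cond Hz.
  have Ey : y = x ^- 3 by apply: (mulfI (expf_neq0 3 x0)); rewrite Exy divff ?expf_neq0.
  subst y z.
  have C N : N \in [:: 2; 6; 10; 14; 18; 12; 16; 20; 24; 28]%N -> x ^+ N = 1 -> sporadic T.
    move=> HN xN; have [N0 evN] : (0 < N)%N /\ ~~ odd N.
      by apply/andP; apply: (allP (_ : all (fun N => (0 < N)%N && ~~ odd N) _) _ HN).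
    apply: (check_pair check_131_family HN _ Hk (h := fun _ x => (x, x ^- 3, - 1)) N0 (dvd1n N)
      (expr1n _ 1) xN E) => // w i j w_prim.
    by rewrite /= (prim_root_half evN w_prim) prim_inv // mulnC exprM.
  have {}E2 : T (k + 2) = (- x ^- 2, x ^+ 3, - 1) by rewrite E2; congr (_, _, _); field.
  have [_ _ _ {}Hx2 _] := chain_facts E2.
  (* Squaring removes the sign, which doubles the exponents of x. *)
  have S2 : (- x ^- 2) ^+ 2 = (x ^+ 4)^-1 by field.
  have S3 m : (- x ^- 2) ^+ m.+2 * x ^+ 3 = 1 -> x ^+ (4 * m.+2 - 6) = 1.
    move=> H; have x6 : x ^+ 6 != 0 by rewrite expf_neq0.
    apply: (mulIf x6); rewrite mul1r -exprD subnK; last by lia.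
    rewrite exprM; apply: invr_inj; rewrite -exprVn -S2 exprAC.
    by rewrite (canRL (mulfK (expf_neq0 3 x0)) H) mul1r; field.
  have S1 m : (- x ^- 2) ^+ m = 1 -> x ^+ (4 * m) = 1.
    by move=> H; rewrite exprM; apply: invr_inj; rewrite -exprVn -S2 exprAC H expr1n invr1.
  have := c_after _ erefl; case/is_m_cond: Hx2 => [[_ /S1]|].
    by case: (c (k + 2)) le6 => [|[|[|[|[|[|[|?]]]]]]] // _ xN _; apply: C xN.
  by case: (c (k + 2)) le6 => [|[|[|[|[|[|[|?]]]]]]] // _ /S3 xN _; apply: C xN.
have {Hx1} [X1|X1] : x ^+ 9 * y ^+ 3 * z = -1 \/ x ^+ 3 * y ^+ 2 * z = 1.
- case/is_m1_cond: Hx1 => [|<-]; [by left | right].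
  by rewrite -[(3 ^ 2)%N]/9%N -[(2 * 3)%N]/6%N; field; rewrite ?x0 ?y0.
- have [Ez|Ez] := is_m1_cond Hz.
    subst z; apply: (check_opp check_131_opp (N := 12) _ _ Hk _ _ _ x4 _ E) => //.
    have := congr1 (fun t => t ^+ 4) X1.
    rewrite (_ : (_ * _ * _) ^+ 4 = (x ^+ 4) ^+ 9 * y ^+ 12); last by ring.
    by rewrite x4 expr1n mul1r => ->; ring.
  have Ey : z = y^-1 by apply: (mulIf y0); rewrite Ez mulVf.
  rewrite Ey in E; apply: (check_pair check_131_inv (N := 8) _ _ Hk
    (h := fun x y => (x, y, y^-1)) _ _ x4 _ E) => //.
    have := congr1 (fun t => t ^+ 4) X1.
    rewrite (_ : (_ * _ * _) ^+ 4 = (x ^+ 4) ^+ 9 * (z * y) ^+ 4 * y ^+ 8); last by ring.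
    by rewrite x4 Ez !expr1n !mul1r => ->; ring.
  by move=> w i j w_prim; rewrite /= -(prim_inv _ w_prim).
- have [Ez|Ez] := is_m1_cond Hz.
    subst z; apply: (check_opp check_131_opp (N := 8) _ _ Hk _ _ _ x4 _ E) => //.
    have := congr1 (fun t => t ^+ 4) X1.
    rewrite (_ : (_ * _ * _) ^+ 4 = (x ^+ 4) ^+ 3 * y ^+ 8); last by ring.
    by rewrite x4 expr1n mul1r => ->; ring.
  by case: G2 => //; rewrite -X1; rewrite -[LHS]mulr1 -Ez; ring.
Qed.

(** As [c (k - 1)] > 1, neither z = -1 nor z y = 1 holds. This rules out x^3 y = 1, so x^4 = 1; the
    value 1 at [k + 1] expresses z by x and y, and the value at [k - 1] then bounds the order of
    y. *)
Lemma pattern_31 k : c k = 3 -> c (k + 1) = 1%N ->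
  c (k - 1) = 2 \/ c (k - 1) = 3 /\ c (k - 2) = 1%N -> (3 <= c (k + 2) <= 4)%N -> sporadic T.
Proof.
move=> c3 c1 Ha H34; case E : (T k) => [[x y] z].
have [x0 y0 z0 Hx Hz] := chain_facts E; rewrite c3 in Hx.
have Hk : around_31 (window c (k - 4) 8).
  by rewrite window8 /around_31 /= c3 c1 H34; case: Ha => [->|[-> ->]]; rewrite ?orbT.
have [_ _ _ Hx1 _] := chain_facts (chain_nextE E c3); rewrite c1 in Hx1.
have a_gt1 : (c (k - 1) <= 1)%N -> False by case: Ha => [->|[->]].
have z1 : z = -1 -> False.
  move=> Ez; apply: a_gt1; apply: (is_m_le Hz); left; rewrite Ez sqrrN expr1n; split=> //.
  by rewrite -subr_eq0 -opprD oppr_eq0 (_ : 1 + 1 = 2%:R) // pnatr_eq0.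
have zy1 : z * y = 1 -> False.
  by move=> Ezy; apply: a_gt1; apply: (is_m_le Hz); right; rewrite expr1.
have {Hx1} X1 : x ^+ 9 * y ^+ 3 * z = -1 \/ x ^+ 3 * y ^+ 2 * z = 1.
  case/is_m1_cond: Hx1 => [|<-]; [by left | right].
  by rewrite -[(3 ^ 2)%N]/9%N -[(2 * 3)%N]/6%N; field; rewrite ?x0 ?y0.
have [Exy|x4] : x ^+ 3 * y = 1 \/ x ^+ 4 = 1.
- by case/is_m_cond: Hx => [[]|]; [right | left].
- case: X1 => H.
    case: z1; rewrite -H (_ : _ * _ * z = (x ^+ 3 * y) ^+ 3 * z); last by ring.
    by rewrite Exy expr1n mul1r.
  case: zy1; rewrite -H (_ : _ * _ * z = (x ^+ 3 * y) * (z * y)); last by ring.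
  by rewrite Exy mul1r.
case: X1 => X1.
- have Ez : z = - (x ^+ 3 * (y ^+ 3)^-1).
    have -> : z = x ^+ 9 * y ^+ 3 * z * (x ^+ 3 * (y ^+ 3)^-1).
      have -> : x ^+ 9 * y ^+ 3 * z * (x ^+ 3 * (y ^+ 3)^-1) = (x ^+ 4) ^+ 3 * z by field.
      by rewrite x4 expr1n mul1r.
    by rewrite X1 mulN1r.
  rewrite Ez in E.
  have C N : N \in [:: 36; 48; 20; 32]%N -> (4 %| N)%N -> (0 < N)%N -> ~~ odd N ->
      y ^+ N = 1 -> sporadic T.
    move=> HN N4 N0 evN yN; apply: (check_pair check_31_b HN _ Hk
      (h := fun x y => (x, y, - (x ^+ 3 * (y ^+ 3)^-1))) N0 N4 x4 yN E) => // w i j w_prim.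
    rewrite /= (exprD w (N %/ 2)) (exprD w (3 * i)) (prim_root_half evN w_prim).
    rewrite (prim_inv _ w_prim) mulN1r.
    by rewrite ![(3 * _)%N]mulnC !exprM.
  case: Ha => [a2|[a3 _]].
    rewrite a2 in Hz; case/is_m_cond: Hz => [[_ Hz]|Hz].
      apply: (C 36) => //; have := congr1 (fun t => t ^+ 12) X1.
      rewrite (_ : (_ * _ * _) ^+ 12 = (x ^+ 4) ^+ 27 * (z ^+ 3) ^+ 4 * y ^+ 36); last by ring.
      by rewrite x4 Hz !expr1n !mul1r => ->; ring.
    apply: (C 20) => //; have := congr1 (fun t => t ^+ 8) X1.
    rewrite (_ : (_ * _ * _) ^+ 8 =
      (x ^+ 4) ^+ 18 * (z ^+ 2 * y) ^+ 4 * y ^+ 20); last by ring.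
    by rewrite x4 Hz !expr1n !mul1r => ->; ring.
  rewrite a3 in Hz; case/is_m_cond: Hz => [[_ Hz]|Hz].
    apply: (C 48) => //; have := congr1 (fun t => t ^+ 16) X1.
    rewrite (_ : (_ * _ * _) ^+ 16 = (x ^+ 4) ^+ 36 * (z ^+ 4) ^+ 4 * y ^+ 48); last by ring.
    by rewrite x4 Hz !expr1n !mul1r => ->; ring.
  apply: (C 32) => //; have := congr1 (fun t => t ^+ 12) X1.
  rewrite (_ : (_ * _ * _) ^+ 12 = (x ^+ 4) ^+ 27 * (z ^+ 3 * y) ^+ 4 * y ^+ 32); last by ring.
  by rewrite x4 Hz !expr1n !mul1r => ->; ring.
- have Ez : z = x * (y ^+ 2)^-1.
    have -> : z = x ^+ 3 * y ^+ 2 * z * (x * (y ^+ 2)^-1).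
      have -> : x ^+ 3 * y ^+ 2 * z * (x * (y ^+ 2)^-1) = x ^+ 4 * z by field.
      by rewrite x4 mul1r.
    by rewrite X1 mul1r.
  rewrite Ez in E.
  have C N : N \in [:: 24; 32; 12; 20]%N -> (4 %| N)%N -> (0 < N)%N ->
      y ^+ N = 1 -> sporadic T.
    move=> HN N4 N0 yN; apply: (check_pair check_31_a HN _ Hk
      (h := fun x y => (x, y, x * (y ^+ 2)^-1)) N0 N4 x4 yN E) => // w i j w_prim.
    rewrite /= (exprD w i) (prim_inv _ w_prim).
    by rewrite mulnC exprM.
  case: Ha => [a2|[a3 _]].
    rewrite a2 in Hz; case/is_m_cond: Hz => [[_ Hz]|Hz].
      apply: (C 24) => //; have := congr1 (fun t => t ^+ 12) X1.
      rewrite (_ : (_ * _ * _) ^+ 12 = (x ^+ 4) ^+ 9 * (z ^+ 3) ^+ 4 * y ^+ 24); last by ring.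
      by rewrite x4 Hz !expr1n !mul1r.
    apply: (C 12) => //; have := congr1 (fun t => t ^+ 8) X1.
    rewrite (_ : (_ * _ * _) ^+ 8 = (x ^+ 4) ^+ 6 * (z ^+ 2 * y) ^+ 4 * y ^+ 12); last by ring.
    by rewrite x4 Hz !expr1n !mul1r.
  rewrite a3 in Hz; case/is_m_cond: Hz => [[_ Hz]|Hz].
    apply: (C 32) => //; have := congr1 (fun t => t ^+ 16) X1.
    rewrite (_ : (_ * _ * _) ^+ 16 = (x ^+ 4) ^+ 12 * (z ^+ 4) ^+ 4 * y ^+ 32); last by ring.
    by rewrite x4 Hz !expr1n !mul1r.
  apply: (C 20) => //; have := congr1 (fun t => t ^+ 12) X1.
  rewrite (_ : (_ * _ * _) ^+ 12 = (x ^+ 4) ^+ 9 * (z ^+ 3 * y) ^+ 4 * y ^+ 20); last by ring.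
  by rewrite x4 Hz !expr1n !mul1r.
Qed.

(** * The constant sequence 2 and the alternating sequence 1, 4 *)

Lemma const_2_mixed k x y z : (forall j, c j = 2) -> T k = (x, y, z) ->
  x ^+ 2 * y = 1 -> z ^+ 3 = 1 -> sporadic T.
Proof.
move=> c2 E Exy z3; have [x0 y0 z0 _ _] := chain_facts E.
have Hk : all_2 (window c (k - 4) 8) by rewrite window8 !c2.
have Ey : y = (x ^+ 2)^-1 by apply: (mulfI (expf_neq0 2 x0)); rewrite Exy divff ?expf_neq0.
have C N : N \in [:: 9; 12]%N -> (3 %| N)%N -> (0 < N)%N -> x ^+ N = 1 -> sporadic T.
  move=> HN N3 N0 xN; rewrite Ey in E.
  apply: (check_pair check_2_mixed HN _ Hk
    (h := fun z x => (x, (x ^+ 2)^-1, z)) N0 N3 z3 xN E) => // w i j w_prim.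
  by rewrite /= (prim_inv _ w_prim) mulnC exprM.
have [_ _ _ _] := chain_facts (chain_prevE E (c2 _)).
rewrite c2 => /is_m_cond[[_ H]|H].
  (* The factor x^9 completes the powers of y to powers of x^2 y. *)
  apply: (C 9) => //; have := congr1 (fun t => t * x ^+ 9) H; rewrite mul1r => <-.
  rewrite -[(2 ^ 2)%N]/4%N (_ : _ * x ^+ 9 = (z ^+ 3) ^+ 4 * (x ^+ 2 * y) ^+ 6); last by ring.
  by rewrite z3 Exy !expr1n mul1r.
apply: (C 12) => //; have H1 : z ^+ 4 * y ^+ 3 * x ^+ 2 = 1.
  by rewrite -H -[(2 ^ 2)%N]/4%N -[(2 * 2)%N]/4%N; field; rewrite ?y0 ?z0.
have := congr1 (fun t => t ^+ 3 * x ^+ 12) H1; rewrite expr1n mul1r => <-.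
rewrite (_ : _ * x ^+ 12 = (z ^+ 3) ^+ 4 * (x ^+ 2 * y) ^+ 9); last by ring.
by rewrite z3 Exy !expr1n mul1r.
Qed.

Lemma const_2_roots k x y z : (forall j, c j = 2) -> T k = (x, y, z) ->
  x != 1 -> x ^+ 3 = 1 -> z != 1 -> z ^+ 3 = 1 -> sporadic T.
Proof.
move=> c2 E x1 x3 z1 z3; have [x0 y0 z0 _ _] := chain_facts E.
have Hk : all_2 (window c (k - 4) 8) by rewrite window8 !c2.
have yN : y ^+ 6 = 1 \/ y ^+ 9 = 1.
  have [_ _ _ + _] := chain_facts (chain_nextE E (c2 _)).
  rewrite c2 -[(2 ^ 2)%N]/4%N -[(2 * 2)%N]/4%N => /is_m_cond[[_ H]|H]; [left | right].
    rewrite -H (_ : (_ * _ * _) ^+ 3 = (x ^+ 3) ^+ 4 * z ^+ 3 * y ^+ 6); last by ring.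
    by rewrite x3 z3 expr1n !mul1r.
  have H1 : x ^+ 4 * y ^+ 3 * z ^+ 2 = 1 by rewrite -H; field; rewrite ?x0 ?y0.
  have := congr1 (fun t => t ^+ 3) H1; rewrite expr1n => <-.
  rewrite (_ : (_ * _ * _) ^+ 3 = (x ^+ 3) ^+ 4 * (z ^+ 3) ^+ 2 * y ^+ 9); last by ring.
  by rewrite x3 z3 !expr1n !mul1r.
have quad u : u != 1 -> u ^+ 3 = 1 -> u ^+ 2 + u + 1 = 0 :> R[i].
  move=> u1 u3; have : (u - 1) * (u ^+ 2 + u + 1) == 0.
    by rewrite (_ : _ * _ = u ^+ 3 - 1); [rewrite u3 subrr | ring].
  by rewrite mulf_eq0 subr_eq0 (negbTE u1) => /eqP.
(* Both entries are primitive cube roots of unity, so z is x or its square. *)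
have : (z - x) * (z - x ^+ 2) == 0.
  have Ex := quad x x1 x3; have Ez := quad z z1 z3.
  rewrite (_ : _ * _ = (z ^+ 2 + z + 1) - z * (x ^+ 2 + x + 1) + (x ^+ 3 - 1)); last by ring.
  by rewrite Ex Ez x3 mulr0 !subrr addr0.
rewrite mulf_eq0 !subr_eq0 => /orP[/eqP Ez|/eqP Ez]; rewrite Ez in E.
  have C N : N \in [:: 6; 9]%N -> (3 %| N)%N -> (0 < N)%N -> y ^+ N = 1 -> sporadic T.
    move=> HN N3 N0 yN'; apply: (check_pair check_2_eq HN _ Hk
      (h := fun x y => (x, y, x)) N0 N3 x3 yN' E) => //.
  by case: yN; [apply: (C 6) | apply: (C 9)].
have C N : N \in [:: 6; 9]%N -> (3 %| N)%N -> (0 < N)%N -> y ^+ N = 1 -> sporadic T.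
  move=> HN N3 N0 yN'; apply: (check_pair check_2_inv HN _ Hk
    (h := fun x y => (x, y, x ^+ 2)) N0 N3 x3 yN' E) => // w i j _.
  by rewrite /= mulnC exprM.
by case: yN; [apply: (C 6) | apply: (C 9)].
Qed.

(** Only x^4 y = 1 together with z y = 1 leaves a free parameter; each other pair of alternatives
    makes the triple a triple of roots of unity of bounded order. *)
Lemma alternating_14 k x y z :
  (forall j, (c j = 4 /\ c (j + 1) = 1%N) \/ (c j = 1%N /\ c (j + 1) = 4)) ->
  c k = 4 -> T k = (x, y, z) ->
  [/\ [&& x != 0, x != 1, x != -1, ~~ 3.-primitive_root x & ~~ 4.-primitive_root x],
      y = x ^- 4 & z = x ^+ 4] \/ sporadic T.
Proof.
move=> alt c4 E; have [x0 y0 z0 Hx Hz] := chain_facts E.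
have alt4 j : c j = 4 -> c (j + 1) = 1%N /\ c (j - 1) = 1%N.
  move=> Ej; split; first by case: (alt j) => -[]; rewrite Ej.
  by case: (alt (j - 1)) => -[]; rewrite subrK Ej.
have alt1 j : c j = 1%N -> c (j + 1) = 4 /\ c (j - 1) = 4.
  move=> Ej; split; first by case: (alt j) => -[]; rewrite Ej.
  by case: (alt (j - 1)) => -[]; rewrite subrK Ej.
have k2 : k + 1 + 1 = k + 2 by lia.
have k3 : k + 2 + 1 = k + 3 by lia.
have k2' : k - 1 - 1 = k - 2 by lia.
have k3' : k - 2 - 1 = k - 3 by lia.
have k4' : k - 3 - 1 = k - 4 by lia.
have [p1 m1] := alt4 _ c4; have [p2 _] := alt1 _ p1; rewrite k2 in p2.
have [p3 _] := alt4 _ p2; rewrite k3 in p3.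
have [_ m2] := alt1 _ m1; rewrite k2' in m2.
have [_ m3] := alt4 _ m2; rewrite k3' in m3.
have [_ m4] := alt1 _ m3; rewrite k4' in m4.
have Hk : all_14 (window c (k - 4) 8) by rewrite window8 c4 m1 p1 m2 m3 m4 p2 p3.
rewrite c4 in Hx; rewrite m1 in Hz.
have [Exy|[x1 x5]] : x ^+ 4 * y = 1 \/ x != 1 /\ x ^+ 5 = 1.
- by case/is_m_cond: Hx => [[]|]; [right | left].
- have Ey : y = x ^- 4 by apply: (mulfI (expf_neq0 4 x0)); rewrite Exy divff ?expf_neq0.
  case/is_m1_cond: Hz => Ez.
    right; subst y z.
    have C N : N \in [:: 30; 8]%N -> ~~ odd N -> (0 < N)%N -> x ^+ N = 1 -> sporadic T.
      move=> HN evN N0 xN.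
      apply: (check_pair check_14_family HN _ Hk
        (h := fun _ x => (x, x ^- 4, - 1)) N0 (dvd1n N) (expr1n _ 1) xN E) => // w i j w_prim.
      by rewrite /= (prim_root_half evN w_prim) (prim_inv _ w_prim) mulnC exprM.
    have E1 : T (k + 1) = (-1, x ^- 4, x).
      rewrite (chain_nextE E c4) -[(4 ^ 2)%N]/16%N -[(2 * 4)%N]/8%N.
      by congr (_, _, _); field.
    have E2 : T (k + 2) = (- x ^- 3, x ^+ 4, -1).
      by rewrite -k2 (chain_nextE E1 p1); congr (_, _, _); field.
    have [_ _ _ Hx2 _] := chain_facts E2; rewrite p2 in Hx2.
    case/is_m_cond: Hx2 => [[_ H]|H].
      apply: (C 30) => //; apply: invr_inj; rewrite invr1.
      have := congr1 (fun t => t ^+ 2) H; rewrite expr1n => <-.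
      by field.
    by apply: (C 8) => //; apply: invr_inj; rewrite invr1 -H; field.
  left; have Ez' : z = x ^+ 4 by rewrite -[LHS]mulr1 -Exy mulrCA Ez mulr1.
  (* The excluded parameters would make the value at [k] smaller than 4. *)
  split=> //; rewrite x0 /=.
  have y1 : y != 1.
    by apply/eqP => y1; have : (4 <= 0)%N by apply: (is_m_le Hx); right; rewrite mul1r.
  have x41 : x ^+ 4 != 1.
    by apply: contra_neq y1 => x41; rewrite -Exy x41 mul1r.
  have x1 : x != 1 by apply: contra_neq x41 => ->; rewrite expr1n.
  apply/and4P; split=> //.
  - by apply: contra_neq x41 => ->; ring.
  - apply/negP => /prim_expr_order x3.
    by have : (4 <= 2)%N by apply: (is_m_le Hx); left.
  - by apply: contra x41 => /prim_expr_order ->.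
right; have [_ _ _ Hx1 _] := chain_facts (chain_nextE E c4).
rewrite p1 -[(4 ^ 2)%N]/16%N -[(2 * 4)%N]/8%N in Hx1.
case/is_m1_cond: Hz => Ez.
  subst z; have C N : N \in [:: 40; 30]%N -> (5 %| N)%N -> ~~ odd N -> (0 < N)%N ->
      y ^+ N = 1 -> sporadic T.
    move=> HN N5 evN N0 yN.
    by apply: (check_opp check_14_opp HN _ Hk N0 N5 evN x5 yN E).
  case/is_m1_cond: Hx1 => H.
    apply: (C 40) => //; have := congr1 (fun t => t ^+ 10) H.
    rewrite (_ : (_ * _ * _) ^+ 10 = (x ^+ 5) ^+ 32 * y ^+ 40); last by ring.
    by rewrite x5 expr1n mul1r => ->; ring.
  apply: (C 30) => //; have H1 : - (x ^+ 8 * y ^+ 3) = 1 by rewrite -H; field; rewrite ?x0 ?y0.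
  have := congr1 (fun t => t ^+ 10) H1; rewrite expr1n => <-.
  rewrite (_ : (- _) ^+ 10 = (x ^+ 5) ^+ 16 * y ^+ 30); last by ring.
  by rewrite x5 expr1n mul1r.
have Ez' : z = y^-1 by apply: (mulIf y0); rewrite Ez mulVf.
rewrite Ez' in E; apply: (check_pair check_14_inv (N := 30) _ _ Hk
    (h := fun x y => (x, y, y^-1)) _ _ x5 _ E) => //.
  case/is_m1_cond: Hx1 => H.
    have := congr1 (fun t => t ^+ 10) H.
    rewrite (_ : (_ * _ * _) ^+ 10 = (x ^+ 5) ^+ 32 * (z * y) ^+ 10 * y ^+ 30); last by ring.
    by rewrite x5 Ez !expr1n !mul1r => ->; ring.
  have H1 : x ^+ 8 * y ^+ 3 * z = 1 by rewrite -H; field; rewrite ?x0 ?y0.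
  have := congr1 (fun t => t ^+ 15) H1; rewrite expr1n => <-.
  rewrite (_ : (_ * _ * _) ^+ 15 = (x ^+ 5) ^+ 24 * (z * y) ^+ 15 * y ^+ 30); last by ring.
  by rewrite x5 Ez !expr1n !mul1r.
by move=> w i j w_prim; rewrite /= -(prim_inv _ w_prim).
Qed.

Lemma pattern_sporadic k (v : nat -> nat) : (forall i, v i = c (k + i%:Z)) ->
  pattern_at c v -> sporadic T.
Proof.
move=> Ev; have E0 := Ev 0%N; have E1 := Ev 1%N; have E2 := Ev 2.
have E3 := Ev 3; have E4 := Ev 4.
rewrite addr0 in E0.
have k1 : k + 1 - 1 = k by lia.
have k2 : k + 1 + 1 = k + 2 by lia.
have k3 : k + 1 + 2 = k + 3 by lia.
have k4 : k + 1 + 3 = k + 4 by lia.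
have k22 : k + 2 - 2 = k by lia.
have k21 : k + 2 - 1 = k + 1 by lia.
have k23 : k + 2 + 1 = k + 3 by lia.
have k24 : k + 2 + 2 = k + 4 by lia.
rewrite /pattern_at E0 E1 E2 E3 E4.
case=> [[a b d]|[a b d]|[le6 a b]|[[a b d e]|[a b d e f]|[a b d e]|[a b d e f]]].
- by apply: (pattern_12l (k := k + 1)); rewrite ?k1 ?k2 ?k3.
- by apply: (pattern_12r (k := k + 2)); rewrite ?k21 ?k22.
- by apply: (pattern_12b (k := k + 1)); rewrite ?k1.
- by apply: (pattern_131 (k := k + 1)); rewrite ?k1 ?k2 ?k3 ?k4 //; left.
- by apply: (pattern_131 (k := k + 1)); rewrite ?k1 ?k2 ?k3 ?k4 //; right.
- by apply: (pattern_31 (k := k + 1)); rewrite ?k1 ?k2 ?k3 ?k4 //; left.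
- by apply: (pattern_31 (k := k + 2)); rewrite ?k21 ?k22 ?k23 ?k24 //; right.
Qed.

End Cases.

(** * Classification *)

Lemma reverse_solution (c y : int -> nat) :
  (forall j, (c j * y j = y (j - 1)%R + y (j + 1)%R)%N) ->
  forall j, (c (- j - 1)%R * y (- j - 1)%R = y (- (j - 1) - 1)%R + y (- (j + 1) - 1)%R)%N.
Proof. by move=> cy j; rewrite cy addnC; congr (y _ + y _)%N; lia. Qed.

Lemma constant_periodic c : (forall j, c j = 2) -> periodic_with_block c [:: 2].
Proof. by move=> c2; exists 0 => j; rewrite c2 modz1. Qed.

Lemma alternating_periodic c :
  (forall j, (c j = 4 /\ c (j + 1) = 1%N) \/ (c j = 1%N /\ c (j + 1) = 4)) ->
  periodic_with_block c [:: 1; 4]%N.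
Proof.
move=> alt; have [s cs] : exists s, c s = 1%N.
  by case: (alt 0) => -[c0 c1]; [exists (0 + 1) | exists 0].
have cE j : ((j %% 2)%Z = 0 /\ c (s + j) = 1%N) \/ ((j %% 2)%Z = 1 /\ c (s + j) = 4).
  elim/int_ind: j => [|n IH|n IH]; first by left; rewrite addr0.
    have := alt (s + n%:Z); rewrite (_ : s + n%:Z + 1 = s + n.+1%:Z); last by lia.
    by case: IH => -[En ->] [[// _ ->]|[// _ ->]]; [right | left]; split=> //; lia.
  have := alt (s - n.+1%:Z); rewrite (_ : s - n.+1%:Z + 1 = s - n%:Z); last by lia.
  by case: IH => -[En ->] [[-> //]|[-> //]] _; [right | left]; split=> //; lia.
by exists s => j /=; case: (cE j) => -[-> ->].
Qed.

Section Main.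
Variables (R : realType) (T : int -> triple R) (c : int -> nat).
Hypotheses (HT : chain T c) (c_affine : affine_sequence c).

Lemma sporadic_classified : sporadic T -> classified T c.
Proof.
case=> k [r [z [e [r_in z_prim e_in E]]]].
exact: row_classified r_in z_prim e_in E.
Qed.

Lemma has_pattern_sporadic : has_pattern c -> sporadic T.
Proof.
have [y [y_gt0 cy]] := affine_solution c_affine.
case=> k [Hk|Hk]; first by apply: (pattern_sporadic HT y_gt0 cy (k := k) _ Hk).
apply: sporadic_reverse.
(* The reversed sequence takes the value [c (k - i)] at the place [- k - 1 + i]. *)
apply: (pattern_sporadic (chain_reverse HT) _ (reverse_solution cy) (k := - k - 1)
  (v := fun i => c (k - i%:Z))) => [//|i|]; first by congr c; lia.
case: Hk => [H|H|[le6 a b]|[H|H|H|H]].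
- by constructor 1.
- by constructor 2.
- by constructor 3.
- by constructor 4; constructor 1.
- by constructor 4; constructor 2.
- by constructor 4; constructor 3.
- by constructor 4; constructor 4.
Qed.

Lemma constant_classified : (forall j, c j = 2) -> classified T c.
Proof.
have [y [y_gt0 cy]] := affine_solution c_affine => c2.
case E : (T 0) => [[q1 q] q2].
have [x0 y0 z0 Hx Hz] := chain_facts HT E; rewrite !c2 in Hx Hz.
case/is_m_cond: (Hx) => [[x1 x3]|Ex]; case/is_m_cond: (Hz) => [[z1 z3]|Ez].
- apply: sporadic_classified.
  exact: (const_2_roots HT y_gt0 cy c2 E x1 x3 z1 z3).
- apply: sporadic_classified; apply: sporadic_reverse.
  have E' : swap (T (- 0)) = (q2, q, q1) by rewrite oppr0 E.
  exact: (const_2_mixed (chain_reverse HT) (fun j => y_gt0 _) (reverse_solution cy)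
    (fun j => c2 _) E' Ez x3).
- apply: sporadic_classified.
  exact: (const_2_mixed HT y_gt0 cy c2 E Ex z3).
exists [:: 2]; split; last exact: constant_periodic.
have Eq : q = q1 ^- 2 by apply: (mulfI (expf_neq0 2 x0)); rewrite Ex divff ?expf_neq0.
have q_neq1 : q1 ^+ 2 != 1.
  apply/eqP => q12; have : (2 <= 0)%N; last by [].
  by apply: (is_m_le Hx); right; rewrite mul1r -Ex q12 mul1r.
have q1_neq1 : q1 != 1 by apply: contra_neq q_neq1 => ->; rewrite expr1n.
have q1_neqN1 : q1 != -1 by apply: contra_neq q_neq1 => ->; rewrite sqrrN expr1n.
have : q2 ^+ 2 == q1 ^+ 2.
  by apply/eqP; apply: (mulIf y0); rewrite Ez Ex.
rewrite E Eq eqf_sqr => /orP[] /eqP ->; left.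
- exact: Row12.
- exact: Row13.
Qed.

Lemma alternating_classified :
  (forall j, (c j = 4 /\ c (j + 1) = 1%N) \/ (c j = 1%N /\ c (j + 1) = 4)) ->
  classified T c.
Proof.
have [y [y_gt0 cy]] := affine_solution c_affine => alt.
case E : (T 0) => [[q1 q] q2].
have listed14 (x : R[i]) : [&& x != 0, x != 1, x != -1,
    ~~ 3.-primitive_root x & ~~ 4.-primitive_root x] ->
    listed (x, x ^- 4, x ^+ 4) [:: 1; 4]%N.
  by case/and5P; apply: Row14.
have [c0|c0] : c 0 = 4 \/ c 0 = 1%N by case: (alt 0) => -[]; [left | right].
  have [[Hq1 Eq Eq2]|/sporadic_classified //] := alternating_14 HT y_gt0 cy alt c0 E.
  exists [:: 1; 4]%N; split; last exact: alternating_periodic.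
  by left; rewrite E Eq Eq2; apply: listed14.
(* [alternating_14] needs a value 4 at the place itself; reversing the chain brings the one at -1 to
   0. *)
have c1 : c (- 0 - 1) = 4 by case: (alt (- 0 - 1)) => -[]; rewrite // oppr0 subrK c0.
have alt' j : (c (- j - 1) = 4 /\ c (- (j + 1) - 1) = 1%N) \/
    (c (- j - 1) = 1%N /\ c (- (j + 1) - 1) = 4).
  have := alt (- (j + 1) - 1); rewrite (_ : - (j + 1) - 1 + 1 = - j - 1); last by lia.
  by case=> -[-> ->]; [right | left].
have E' : swap (T (- 0)) = (q2, q, q1) by rewrite oppr0 E.
have [[Hq2 Eq Eq1]|/sporadic_reverse/sporadic_classified //] :=
  alternating_14 (chain_reverse HT) (fun j => y_gt0 _) (reverse_solution cy) alt' c1 E'.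
exists [:: 1; 4]%N; split; last exact: alternating_periodic.
by right; rewrite E /= Eq Eq1; apply: listed14.
Qed.

Lemma affine_classified : classified T c.
Proof.
have [|/alternating_classified //|/has_pattern_sporadic/sporadic_classified //] :=
  affine_pattern c_affine.
exact: constant_classified.
Qed.

End Main.

Theorem theorem4p4 (R : realType) (q1 q q2 : R[i])
    (q1_neq0 : q1 != 0) (q_neq0 : q != 0) (q2_neq0 : q2 != 0)
    (q_affine : affine_triple (q1, q, q2)) :
  exists b : seq nat,
    (listed (q1, q, q2) b \/ listed (swap (q1, q, q2)) b) /\
    (exists c : int -> nat,
       characteristic_sequence (q1, q, q2) c /\ periodic_with_block c b).
Proof.
have [c [c_char c_affine]] := q_affine.
have nz : nonzero (q1, q, q2) by rewrite /= q1_neq0 q_neq0.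
have [T HT T0] := characteristic_chain nz c_char.
have [b [Hb per]] := affine_classified HT c_affine.
by exists b; rewrite -T0; split=> //; exists c; rewrite T0.
Qed.
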